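(* Let $n\ge 1$ and $k\ge 0$. The coefficient of $x^k$ in the toric $g$-polynomial of the $n$-dimensional associahedron is the number of $123$-avoiding parking functions $f:[n]\to[n]$ having exactly $k$ ascents.
   Context: $[n]=\{1,\ldots,n\}$. The $n$-dimensional associahedron is the simple polytope whose nonempty faces correspond to the sets of pairwise noncrossing diagonals of a convex $(n+3)$-gon, ordered by reverse inclusion (so it has $C_{n+1}=\frac1{n+2}\binom{2n+2}{n+1}$ vertices). Toric $g$-polynomial: for an Eulerian poset $P$ with rank function $\rho$, minimum $\hat 0$ and maximum $\hat 1$, the polynomials $f(P,x)$ and $g(P,x)$ are defined recursively. For the one-element poset, $f=g=1$. If $\operatorname{rank} P=n+1>0$, then $f(P,x)=\sum_{y\in P\setminus\{\hat 1\}} g([\hat 0,y],x)(x-1)^{n-\rho(y)}$; writing $f(P,x)=h_0+h_1x+\cdots+h_nx^n$, one sets $g(P,x)=h_0+(h_1-h_0)x+\cdots+(h_m-h_{m-1})x^m$ with $m=\lfloor n/2\rfloor$. The toric $g$-polynomial of an $n$-dimensional polytope is that of its face lattice (all faces including the empty face and the polytope itself, ordered by inclusion, of rank $n+1$). For a function $f:[n]\to[n]$: $f$ is a parking function if $|f^{-1}([k])|\ge k$ for all $1\le k\le n$; $f$ is $123$-avoiding if there is no triple $1\le i_1<i_2<i_3\le n$ with $f(i_1)\le f(i_2)\le f(i_3)$; $f$ has an ascent at position $i$ if $1\le i\le n-1$ and $f(i)\le f(i+1)$ (weak inequality). *)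

(* Defs.v *)
From HB Require Import structures.
From mathcomp Require Import all_boot all_order all_algebra.

Set Implicit Arguments.
Unset Strict Implicit.
Unset Printing Implicit Defensive.

Import Order.TTheory GRing.Theory Num.Theory.

Section ToricPolynomials.
Local Open Scope order_scope.
Context {d : Order.disp_t} {P : finTBPOrderType d}.
Implicit Types (x y z : P) (C : {set P}).

Definition is_chain C : bool := [forall x in C, forall y in C, x >=< y].

(* The length of a longest chain from \bot to y, counted as the number of its
   elements other than y. In a graded poset (in particular in an Eulerian poset,
   or in the face lattice of a polytope) this is the rank function. *)
Definition rank y : nat :=
  \max_(C : {set P} | is_chain C && [forall x in C, x < y]) #|C|.

Lemma rank_lt z y : z < y -> (rank z < rank y)%N.
Proof.
move=> lt_zy.
pose D := fun C => is_chain C && [forall x in C, x < z].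
have D0 : D set0.
  by apply/andP; split; apply/forall_inP => x; rewrite inE.
have [C /andP[/forall_inP chC /forall_inP ltC] eC] :
    exists2 C, D C & rank z = #|C|.
  have [|C DC eC] := @eq_bigmax_cond {set P} D (fun C => #|C|).
    by apply/card_gt0P; exists set0.
  by exists C.
have zC : z \notin C by apply/negP => /ltC; rewrite ltxx.
have -> : (rank z).+1 = #|z |: C| by rewrite cardsU1 zC eC.
apply: (@leq_bigmax_cond _ _ (fun C => #|C|)); apply/andP; split.
  apply/forall_inP => u /setU1P[-> | uC]; apply/forall_inP => v /setU1P[-> | vC].
  - exact: comparablexx.
  - by rewrite comparable_sym lt_comparable ?ltC.
  - by rewrite lt_comparable ?ltC.
  - by have /forall_inP := chC u uC; apply.
apply/forall_inP => u /setU1P[-> // | uC].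
exact: lt_trans (ltC u uC) lt_zy.
Qed.

Lemma rank_bot : rank \bot = 0%N.
Proof.
apply/eqP; rewrite -leqn0; apply/bigmax_leqP => C /andP[_ /forall_inP ltC].
rewrite leqn0 cards_eq0; apply/eqP/setP => x; rewrite inE.
by apply/negP => /ltC; rewrite ltx0.
Qed.

Local Open Scope ring_scope.

(* h_0 + (h_1 - h_0) x + ... + (h_m - h_(m-1)) x^m with m = floor(n/2), where
   h = h_0 + ... + h_n x^n *)
Definition g_of_f (n : nat) (h : {poly int}) : {poly int} :=
  \poly_(i < (n./2).+1) (h`_i - (if i is j.+1 then h`_j else 0)).

(* The mutual recursion runs over the lower intervals [\bot, y], whose rank
   functions are restrictions of that of P. The argument m is fuel; toric_f
   and toric_gE give the fuel-free recursion. *)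
Fixpoint g_fuel (m : nat) (y : P) {struct m} : {poly int} :=
  if m is m'.+1 then
    if rank y is n.+1 then
      g_of_f n (\sum_(z : P | (z < y)%O)
                  g_fuel m' z * ('X - 1) ^+ (n - rank z))
    else 1
  else 1.

(* g([\bot, y], x) *)
Definition toric_g (y : P) : {poly int} := g_fuel (rank y) y.

(* f([\bot, y], x) *)
Definition toric_f (y : P) : {poly int} :=
  if rank y is n.+1 then
    \sum_(z : P | (z < y)%O) toric_g z * ('X - 1) ^+ (n - rank z)
  else 1.

Lemma g_fuelE (m : nat) (y : P) : (rank y <= m)%N -> g_fuel m y = toric_g y.
Proof.
rewrite /toric_g; elim/ltn_ind: m y => m IHm y le_ym.
case: m => [|m] in IHm le_ym *; first by move: le_ym; rewrite leqn0 => /eqP ->.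
case ey: (rank y) => [|n] /=; rewrite ey //.
congr (g_of_f n _); apply: eq_bigr => z /rank_lt; rewrite ey ltnS => le_zn.
have le_nm : (n <= m)%N by rewrite -ltnS -ey.
by rewrite !IHm ?ltnS // (leq_trans le_zn).
Qed.

Lemma toric_gE (y : P) :
  toric_g y = if rank y is n.+1 then g_of_f n (toric_f y) else 1.
Proof.
rewrite /toric_f {1}/toric_g; case ey: (rank y) => [|n] //=; rewrite ey.
congr (g_of_f n _); apply: eq_bigr => z /rank_lt; rewrite ey ltnS => le_zn.
by rewrite g_fuelE.
Qed.

End ToricPolynomials.

Definition toric_g_poly {d : Order.disp_t} (P : finTBPOrderType d) :
  {poly int} := toric_g (\top%O : P).

Section Associahedron.
Variable n : nat.

(* The vertices of the (n+3)-gon are 0, ..., n+2 in cyclic order; the diagonal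
   joining a and b is encoded by the pair (a, b) with a < b. *)
Local Notation segment := ('I_n.+3 * 'I_n.+3)%type.
Implicit Types (p q : segment) (S : {set segment}).

Definition is_diagonal p : bool :=
  (p.1.+1 < p.2) && ~~ ((p.1 == 0 :> nat) && (p.2 == n.+2 :> nat)).

Definition crossing p q : bool :=
  (p.1 < q.1 < p.2) && (p.2 < q.2) || (q.1 < p.1 < q.2) && (q.2 < p.2).

Definition is_dissection S : bool :=
  [forall p in S, is_diagonal p]
  && [forall p in S, forall q in S, ~~ crossing p q].

Definition dissection := {S : {set segment} | is_dissection S}.

(* None is the empty face; Some S is the nonempty face labelled by S. *)
Definition associahedron_face := option dissection.

HB.instance Definition _ := Finite.copy associahedron_face (option dissection).

Definition face_le (F G : associahedron_face) : bool :=
  match F, G with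
  | None, _ => true
  | Some _, None => false
  | Some A, Some B => val B \subset val A
  end.

Lemma face_le_refl : reflexive face_le.
Proof. by case=> [A|] /=. Qed.

Lemma face_le_anti : antisymmetric face_le.
Proof.
case=> [A|] [B|] //= /andP[sBA sAB]; congr Some; apply/val_inj/eqP.
by rewrite eqEsubset sAB.
Qed.

Lemma face_le_trans : transitive face_le.
Proof. by case=> [A|] [B|] [C|] //= sAB sCA; exact: subset_trans sAB. Qed.

Fact associahedron_display : Order.disp_t. Proof. exact: Order.Disp tt tt. Qed.

HB.instance Definition _ :=
  Order.Le_isPOrder.Build associahedron_display associahedron_face
    face_le_refl face_le_anti face_le_trans.

Lemma is_dissection0 : is_dissection set0.
Proof. by apply/andP; split; apply/forall_inP => p; rewrite inE. Qed.

Definition whole_face : associahedron_face := Some (Sub set0 is_dissection0).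

Lemma face_le0x (F : associahedron_face) : (None <= F :> associahedron_face)%O.
Proof. by []. Qed.

Lemma face_lex1 (F : associahedron_face) : (F <= whole_face)%O.
Proof. by case: F => [A|] //=; apply: sub0set. Qed.

HB.instance Definition _ :=
  Order.hasBottom.Build associahedron_display associahedron_face face_le0x.
HB.instance Definition _ :=
  Order.hasTop.Build associahedron_display associahedron_face face_lex1.

End Associahedron.

(* Face lattice of the n-dimensional associahedron. *)
Definition associahedron (n : nat) : finTBPOrderType associahedron_display :=
  associahedron_face n.

Section ParkingFunctions.
Variable n : nat.
(* [n] is encoded by 'I_n, i.e. arguments and values are shifted down by 1; so
   f^-1([k]) is the set of i with f i < k. *)
Implicit Type f : {ffun 'I_n -> 'I_n}.

Definition is_parking f : bool :=
  [forall k : 'I_n.+1, (0 < k) ==> (k <= #|[set i | f i < k]|)].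

Definition avoids123 f : bool :=
  ~~ [exists i1 : 'I_n, exists i2 : 'I_n, exists i3 : 'I_n,
        [&& i1 < i2, i2 < i3, f i1 <= f i2 & f i2 <= f i3]].

(* Weak ascents. *)
Definition ascents f : {set 'I_n} :=
  [set i : 'I_n | [exists j : 'I_n, (j == i.+1 :> nat) && (f i <= f j)]].

End ParkingFunctions.

(* Main.v *)
Require Import Defs.
From mathcomp Require Import all_boot all_order all_algebra.
From mathcomp Require Import zify ring.

(* Let D range over the dissections of the (n+3)-gon and let h_D be the
   h-polynomial of the face labelled by D, which is symmetric by Euler's
   relation. Kazhdan-Lusztig-Stanley uniqueness identifies the toric
   g-polynomial of the face labelled by D with the alternating sum, over the
   dissections E containing D, of the truncations of (1 - x) h_E; for D empty
   this is a linear functional of the symmetric polynomial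
     H(u,v) = sum_D (v - u)^(n - |D|) (1 - v)^|D|,
   reading off its expansion in Schur functions. Splitting a polygon at a
   triangle shows that H is the sum over Motzkin paths of length n with weight
   2 - u - v for a level step and (1 - u)(1 - v) for an up step.
   On the other side, a 123-avoiding parking function is built by inserting the
   letters 1, 2, ... in order, each of them zero, one or two times, so that its
   content is a Motzkin path. The functionals of words that count the ascents and
   the positions of insertion satisfy the same recursion as those on H, because
   inserting a letter twice acts as inserting it once plus (x - 1) times the
   identity, just as (1 - u)(1 - v) = (2 - u - v) + (uv - 1). *)

Set Implicit Arguments.
Unset Strict Implicit.
Unset Printing Implicit Defensive.

Import Order.TTheory GRing.Theory Num.Theory.

(** * Words: ascents, decreasing runs, insertion of a largest letter *)

Fixpoint avoids (w : seq nat) : bool :=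
  if w is a :: w' then sorted gtn [seq b <- w' | a <= b] && avoids w' else true.

Fixpoint nb_asc (w : seq nat) : nat :=
  if w is a :: w' then (if w' is b :: _ then a <= b : nat else 0) + nb_asc w'
  else 0.

(** Length of the longest strictly decreasing prefix. In a 123-avoiding word, a new largest letter
    may be inserted exactly at the positions [p <= dec_run w] (see [avoids_insert]). *)
Fixpoint dec_run (w : seq nat) : nat :=
  if w is a :: w' then
    if w' is b :: _ then if b < a then (dec_run w').+1 else 1 else 1
  else 0.

Definition insert p (m : nat) w := take p w ++ m :: drop p w.

Arguments dec_run : simpl never.
Arguments nb_asc : simpl never.

Section WordInsertion.
Implicit Types (a b m p : nat) (w : seq nat).

Lemma dec_run_cons2 a b w :
  dec_run (a :: b :: w) = if b < a then (dec_run (b :: w)).+1 else 1.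
Proof. by []. Qed.

Lemma nb_asc_cons2 a b w : nb_asc (a :: b :: w) = (a <= b) + nb_asc (b :: w).
Proof. by []. Qed.

Lemma dec_run_gt0 a w : 0 < dec_run (a :: w).
Proof. by case: w => [|b w] //; rewrite dec_run_cons2; case: ifP. Qed.

Lemma dec_run_size w : dec_run w <= size w.
Proof. by elim: w => [|a [|b w] IH] //; rewrite dec_run_cons2; case: ifP. Qed.

Lemma size_insert p m w : size (insert p m w) = (size w).+1.
Proof. by rewrite /insert size_cat /= addnS -size_cat cat_take_drop. Qed.

Lemma nb_asc_dec_run w : dec_run w = size w -> nb_asc w = 0.
Proof.
elim: w => [|a [|b w] IH] //.
rewrite dec_run_cons2 nb_asc_cons2; case: ltnP => // lt_ba [e].
by rewrite IH.
Qed.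

Lemma dec_run_cons_max m w : all (gtn m) w -> dec_run (m :: w) = (dec_run w).+1.
Proof. by case: w => [|a w] //= /andP[/= lt_am _]; rewrite dec_run_cons2 lt_am. Qed.

Lemma nb_asc_cons_max m w : all (gtn m) w -> nb_asc (m :: w) = nb_asc w.
Proof.
by case: w => [|a w] //= /andP[/= lt_am _]; rewrite nb_asc_cons2 leqNgt lt_am.
Qed.

Lemma insert_cons p m a w : insert p.+1 m (a :: w) = a :: insert p m w.
Proof. by []. Qed.

Lemma insert0 m w : insert 0 m w = m :: w.
Proof. by rewrite /insert take0 drop0. Qed.

Lemma dec_run_insert p m w :
  all (gtn m) w -> 0 < p <= dec_run w -> dec_run (insert p m w) = p.
Proof.
elim: w p => [|a w IH] [|p] //= /andP[/= lt_am wm].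
rewrite insert_cons; case: p => [|p] le_p.
  by rewrite insert0 dec_run_cons2 ltnNge ltnW.
case: w IH wm le_p => [|b w] IH wm //; rewrite dec_run_cons2.
case: (ltnP b a) => // lt_ba le_p.
by have := IH p.+1 wm le_p; rewrite insert_cons dec_run_cons2 lt_ba => ->.
Qed.

(** The letter before [m] now starts an ascent, and [m] itself starts none. Nothing is gained only
    at the end of a run that is followed by an ascent, since that ascent is merely replaced. *)
Lemma nb_asc_insert p m w : all (gtn m) w -> 0 < p <= dec_run w ->
  nb_asc (insert p m w) = nb_asc w + ((p < dec_run w) || (dec_run w == size w)).
Proof.
elim: w p => [|a w IH] [|p] // /= /andP[/= lt_am wm].
rewrite insert_cons; case: p => [|p] le_p.
  rewrite insert0 nb_asc_cons2 nb_asc_cons_max // (ltnW lt_am).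
  case: w {IH le_p} wm => [|b w] // _.
  rewrite dec_run_cons2 nb_asc_cons2 /=.
  by have := dec_run_gt0 b w; case: (ltnP b a) => //=; lia.
case: w IH wm le_p => [|b w] IH wm //; rewrite dec_run_cons2.
case: (ltnP b a) => // lt_ba le_p.
have := IH p.+1 wm le_p; rewrite insert_cons !nb_asc_cons2 => ->.
by rewrite ltnS eqSS leqNgt lt_ba.
Qed.

End WordInsertion.

(** * Functionals of words under insertion of a largest letter *)

Section Weights.
Local Open Scope ring_scope.
Implicit Types (a b e m p : nat) (w : seq nat) (phi psi : nat -> {poly int}).

(** Decreasing words get a value of their own: for them, inserting at the end of the run creates an
    ascent instead of replacing one. *)
Definition weight phi psi w : {poly int} :=
  if dec_run w == size w then psi (size w) else 'X^(nb_asc w) * phi (dec_run w).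

Lemma sum_nat_succ (R : nmodType) (F : nat -> R) n :
  \sum_(0 <= i < n) F i.+1 = \sum_(1 <= i < n.+1) F i.
Proof. by rewrite [RHS]big_add1. Qed.

Lemma sum_weight_insert phi psi m w : all (gtn m) w ->
  \sum_(0 <= p < (dec_run w).+1) weight phi psi (insert p m w) =
  if dec_run w == size w
  then psi (size w).+1 + 'X * \sum_(1 <= p < (size w).+1) phi p
  else 'X^(nb_asc w) *
       (phi (dec_run w).+1 + phi (dec_run w) + 'X * \sum_(1 <= p < dec_run w) phi p).
Proof.
move=> wm; rewrite big_nat_recl // insert0.
rewrite (sum_nat_succ (fun p => weight phi psi (insert p m w))).
rewrite {1}/weight dec_run_cons_max // nb_asc_cons_max //= eqSS.
have le_rs := dec_run_size w.
have E p : (0 < p <= dec_run w)%N -> weight phi psi (insert p m w) =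
    'X^(nb_asc w + ((p < dec_run w)%N || (dec_run w == size w))) * phi p.
  move=> pP; rewrite /weight dec_run_insert // nb_asc_insert // size_insert.
  by rewrite ifF //; lia.
case: eqP => [e|ne].
  rewrite -e; congr (_ + _); rewrite big_distrr /=.
  rewrite big_nat [RHS]big_nat; apply: eq_bigr => p pP.
  by rewrite E // e eqxx orbT (nb_asc_dec_run e).
case: w wm le_rs E ne => [|a w] // wm le_rs E ne.
have r0 := dec_run_gt0 a w.
(* Insertion at the end of the run replaces an ascent, so this is the only remaining summand without
   a factor ['X]. *)
rewrite big_nat_recr //= E; last by lia.
rewrite ltnn (introF eqP ne) addn0 !mulrDr -!addrA; congr (_ + _).
rewrite addrC; congr (_ + _); rewrite mulrA -exprSr big_distrr /=.
rewrite big_nat [RHS]big_nat; apply: eq_bigr => p pP.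
rewrite E; last by lia.
have -> : (p < dec_run (a :: w))%N by lia.
by rewrite addn1.
Qed.

(** For [p > 0] the leading [m] only lengthens the run from p to p + 1; for [p = 0] it adds an
    ascent and leaves a run of length 1. The summands thus shift by one, and for decreasing [w] the
    hypothesis on [psi] absorbs the boundary terms. *)
Lemma sum_weight_cons_insert phi psi m w : all (gtn m) w ->
  (forall s, psi s.+1 = (1 - 'X) * psi s + 'X * phi s.+1) ->
  \sum_(0 <= p < (dec_run w).+1) weight phi psi (m :: insert p m w) =
  \sum_(0 <= p < (dec_run w).+1) weight phi psi (insert p m w) +
  ('X - 1) * weight phi psi w.
Proof.
move=> wm psiS; rewrite sum_weight_insert // big_nat_recl // insert0.
rewrite (sum_nat_succ (fun p => weight phi psi (m :: insert p m w))).
have le_rs := dec_run_size w.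
have -> : weight phi psi [:: m, m & w] = 'X^((nb_asc w).+1) * phi 1%N.
  rewrite /weight dec_run_cons2 nb_asc_cons2 ltnn leqnn /=.
  by rewrite nb_asc_cons_max.
have E p : (0 < p <= dec_run w)%N -> weight phi psi (m :: insert p m w) =
    'X^(nb_asc w + ((p < dec_run w)%N || (dec_run w == size w))) * phi p.+1.
  move=> pP; rewrite -(nb_asc_insert wm pP).
  have R := dec_run_insert wm pP.
  case: p pP R => // p pP; case: w wm le_rs pP => // a w wm le_rs pP R.
  have lt_am : (a < m)%N by case/andP: wm.
  move: R; rewrite /weight insert_cons dec_run_cons2 nb_asc_cons2 lt_am => ->.
  rewrite leqNgt lt_am /= size_insert ifF //.
  by apply/negbTE; move: le_rs pP => /=; lia.
have S1 r : \sum_(1 <= p < r.+1) phi p.+1 + phi 1%N = \sum_(1 <= p < r.+2) phi p.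
  by rewrite big_add1 /= addrC [RHS]big_add1 /= big_nat_recl.
rewrite [weight _ _ w]/weight; case: eqP => [e|ne].
  rewrite psiS -e (nb_asc_dec_run e) expr1 big_nat.
  under eq_bigr => p pP.
    rewrite E // e eqxx orbT (nb_asc_dec_run e) addn1 expr1; over.
  rewrite -big_nat -big_distrr /= -mulrDr addrC S1.
  by rewrite big_nat_recr //= e; ring.
case: w wm le_rs E ne => [|a w] // wm le_rs E ne.
have r0 := dec_run_gt0 a w; case er : (dec_run (a :: w)) r0 ne E => [|r] // _ ne E.
rewrite big_nat_recr //= E; last by lia.
rewrite ltnn (introF eqP ne) addn0 big_nat.
under eq_bigr => p pP.
  rewrite E; last by lia.
  have -> : (p < r.+1)%N by lia.
  rewrite addn1; over.
rewrite -big_nat -big_distrr /= addrA -mulrDr addrC [phi 1%N + _]addrC S1.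
by rewrite big_nat_recr //= exprS; ring.
Qed.

(* On the words in the letters below m, the span of weight_asc and of the
   weight_dec e is stable under summing over the insertions of the letter m.
   Under this insertion weight_asc and weight_dec e behave like the functionals
   sum_e tau e and (-1)^e x^(e+1) tau e defined below. *)
Definition psi_ e s : {poly int} := 'X ^+ e.+1 *+ 'C(s.+1, e.+1).
Definition phi_ e l : {poly int} := 'X ^+ e *+ 'C(l, e) + 'X ^+ e.+1 *+ 'C(l, e.+1).

Lemma sum_bin e l : (\sum_(0 <= p < l) 'C(p, e) = 'C(l, e.+1))%N.
Proof.
elim: l => [|l IH]; first by rewrite big_geq.
by rewrite big_nat_recr //= IH binS addnC.
Qed.

Lemma psi_S e s : psi_ e s.+1 = (1 - 'X) * psi_ e s + 'X * phi_ e s.+1.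
Proof.
rewrite /psi_ /phi_ [in LHS]binS !mulrnDr ?mulrnAr ?mulrnDl.
by rewrite !exprS; ring.
Qed.

Lemma sum_phi e l : (0 < l)%N ->
  \sum_(1 <= p < l) phi_ e p =
  'X ^+ e *+ ('C(l, e.+1) - (e == 0))%N + 'X ^+ e.+1 *+ 'C(l, e.+2).
Proof.
move=> l0; rewrite -(sum_bin e.+1 l) -(sum_bin e l).
(* The sum starts at [p = 1], so the summand C(0, e) is taken out; it is 1 for [e = 0] and 0
   otherwise. *)
rewrite [in X in _ *+ X](big_ltn l0) [X in _ + _ *+ X](big_ltn l0).
rewrite bin0n add0n addKn big_split /= -!sumrMnr.
by [].
Qed.

Definition weight_dec e := weight (phi_ e) (psi_ e).
Definition weight_asc w : {poly int} := 'X^(nb_asc w).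

Lemma weight_ascE w : weight_asc w = weight (fun=> 1) (fun=> 1) w.
Proof.
rewrite /weight /weight_asc; case: eqP => [/nb_asc_dec_run -> // | _].
by rewrite mulr1.
Qed.

(** All but at most two of the insertions gain a factor ['X], so the sum is affine in the length of
    the run; [weight_dec 0] carries the linear term. *)
Lemma sum_weight_asc_insert m w : all (gtn m) w ->
  \sum_(0 <= p < (dec_run w).+1) weight_asc (insert p m w) =
  (1 - 'X) * weight_asc w + weight_dec 0 w.
Proof.
move=> wm; under eq_bigr do rewrite weight_ascE.
rewrite sum_weight_insert // /weight_dec /weight.
rewrite !sumr_const_nat /weight_asc /psi_ /phi_ bin0 !bin1; case: eqP => [e|ne].
  by rewrite (nb_asc_dec_run e) subn1 /= mulrS; ring.
case: w wm ne => // a w wm ne; have := dec_run_gt0 a w.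
case: (dec_run (a :: w)) => // r _; rewrite subn1 /= mulrS; ring.
Qed.

(** Summation over the run raises the lower index of the binomial coefficients. By Pascal's rule the
    result is tridiagonal in [e]: up to signs and powers of ['X], it is the rule of [tau_level]. *)
Lemma sum_weight_dec_insert e m w : all (gtn m) w ->
  \sum_(0 <= p < (dec_run w).+1) weight_dec e (insert p m w) =
  weight_dec e w *+ 2 + weight_dec e.+1 w +
  (if e is e'.+1 then 'X * weight_dec e' w else 0).
Proof.
move=> wm; rewrite sum_weight_insert // /weight_dec /weight.
case: eqP => [er|ne].
  rewrite sum_phi // /psi_.
  case: e => [|e]; rewrite ?bin1 ?subn1 ?subn0 /=.
    by rewrite !mulrS !exprS; ring.
  rewrite 2!binS !mulrnDr !exprS; ring.
case: w wm ne => // a w wm ne; have := dec_run_gt0 a w.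
case: (dec_run (a :: w)) => // r _; rewrite sum_phi // /phi_.
case: e => [|e]; rewrite ?bin0 ?bin1 ?subn1 ?subn0 /=.
  by rewrite !mulrS; ring.
by rewrite (binS r.+1 e) (binS r.+1 e.+1) !mulrnDr !exprS; ring.
Qed.

Lemma sum_weight_asc_cons_insert m w : all (gtn m) w ->
  \sum_(0 <= p < (dec_run w).+1) weight_asc (m :: insert p m w) =
  \sum_(0 <= p < (dec_run w).+1) weight_asc (insert p m w) +
  ('X - 1) * weight_asc w.
Proof.
move=> wm; rewrite weight_ascE.
under eq_bigr do rewrite weight_ascE; under [in RHS]eq_bigr do rewrite weight_ascE.
by apply: sum_weight_cons_insert => // s; ring.
Qed.

Lemma sum_weight_dec_cons_insert e m w : all (gtn m) w ->
  \sum_(0 <= p < (dec_run w).+1) weight_dec e (m :: insert p m w) =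
  \sum_(0 <= p < (dec_run w).+1) weight_dec e (insert p m w) +
  ('X - 1) * weight_dec e w.
Proof. by move=> wm; apply: sum_weight_cons_insert (psi_S e). Qed.

End Weights.

(** * Generating 123-avoiding parking words by insertion *)

Section ParkingWords.
Implicit Types (a b m p : nat) (w : seq nat).

Definition insert1 m ws : seq (seq nat) :=
  [seq insert p m w | w <- ws, p <- index_iota 0 (dec_run w).+1].

Definition insert2 m ws : seq (seq nat) :=
  [seq m :: insert p m w | w <- ws, p <- index_iota 0 (dec_run w).+1].

(* The words of length m + h in the letters 0, ..., m - 1 that avoid 123 and
   have at least k letters smaller than k for all k <= m (see mem_words), built
   by inserting the letters in increasing order. *)
Fixpoint words m h : seq (seq nat) :=
  if m is m'.+1 then
    words m' h.+1 ++ insert1 m' (words m' h)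
    ++ (if h is h'.+1 then insert2 m' (words m' h') else [::])
  else if h is 0 then [:: [::]] else [::].

Lemma count_insert (P : pred nat) p m w :
  count P (insert p m w) = P m + count P w.
Proof.
by rewrite /insert count_cat /= addnCA -count_cat cat_take_drop.
Qed.

Lemma all_insert (P : pred nat) p m w : all P (insert p m w) = P m && all P w.
Proof. by rewrite /insert all_cat /= andbCA -all_cat cat_take_drop. Qed.

Lemma filter_insert p m w : all (gtn m) w -> filter (gtn m) (insert p m w) = w.
Proof.
move=> /all_filterP wm.
by rewrite /insert filter_cat /= ltnn -filter_cat cat_take_drop.
Qed.

Lemma index_insert p m w : all (gtn m) w -> p <= size w ->
  index m (insert p m w) = p.
Proof.
move=> /allP wm le_pw; rewrite /insert index_cat ifN; last first.
  by apply/negP => /mem_take /wm /=; rewrite ltnn.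
by rewrite /= eqxx addn0 size_takel.
Qed.

Lemma filter_nil_all m w : ([seq b <- w | m <= b] == [::]) = all (gtn m) w.
Proof.
by elim: w => //= b w <-; case: leqP.
Qed.

Lemma filter_leq_nil m w : all (gtn m) w -> [seq b <- w | m <= b] = [::].
Proof. by rewrite -filter_nil_all => /eqP. Qed.

Lemma gtn_trans : transitive gtn.
Proof. by move=> b a c /= lt_ba lt_cb; apply: ltn_trans lt_ba. Qed.

Lemma leq_dec_run p w : p <= size w -> (p <= dec_run w) = sorted gtn (take p w).
Proof.
elim: w p => [|a w IH] [|p] //= le_p.
case: w IH le_p => [|b w] IH le_p; first by case: p le_p.
case: p le_p => [|p] le_p; first by rewrite take0 dec_run_gt0.
rewrite dec_run_cons2 /=; case: (ltnP b a) => // lt_ba.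
by rewrite ltnS IH.
Qed.

Lemma sorted_gtn_cat_max u m v : all (gtn m) u -> all (gtn m) v ->
  sorted gtn (u ++ m :: v) = (u == [::]) && sorted gtn v.
Proof.
case: u => [_|b u um] vm /=.
  by rewrite (path_sortedE gtn_trans) vm.
rewrite cat_path /= ltnNge ltnW ?andbF //.
by have /allP/(_ _ (mem_last b u)) := um.
Qed.

(** The strictly largest letter can only end a pattern, so the one new condition is that the letters
    before it be strictly decreasing. *)
Lemma avoids_insert p m w : all (gtn m) w -> p <= size w ->
  avoids (insert p m w) = (p <= dec_run w) && avoids w.
Proof.
move=> wm /[dup] le_p /leq_dec_run ->.
elim: p w wm le_p => [|p IH] w wam; first by rewrite insert0 take0 /= filter_leq_nil.
case: w wam => [|a w] // /andP[lt_am wm]; rewrite ltnS => le_p.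
rewrite insert_cons /= (IH _ wm) // (path_sortedE gtn_trans) /insert filter_cat /=.
rewrite (ltnW lt_am) sorted_gtn_cat_max; last 2 first.
- by apply/allP => b; rewrite mem_filter => /andP[_ /mem_take/(allP wm)].
- by apply/allP => b; rewrite mem_filter => /andP[_ /mem_drop/(allP wm)].
rewrite filter_nil_all -andbA; case: (boolP (all _ (take p w))) => //= tp.
rewrite -[in RHS](cat_take_drop p w) filter_cat (filter_leq_nil tp) /=.
by rewrite andbCA cat_take_drop.
Qed.

Lemma avoids_cons_insert p m w : all (gtn m) w ->
  avoids (m :: insert p m w) = avoids (insert p m w).
Proof.
move=> wm; rewrite /= /insert filter_cat /= leqnn.
rewrite !filter_leq_nil //; apply/allP => b.
  by move/mem_drop/(allP wm).
by move/mem_take/(allP wm).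
Qed.

Variant max_letter_spec m w : Prop :=
  | NoMax of all (gtn m) w
  | OneMax p w' of w = insert p m w' & all (gtn m) w' & p <= size w'
  | TwoMax p w' of w = m :: insert p m w' & all (gtn m) w' & p <= size w'.

(** Of two copies of the largest letter [m] the first must open the word, since an earlier letter
    would form a pattern with both. Three copies already form a pattern. *)
Lemma max_letterP m w : all (gtn m.+1) w -> avoids w -> max_letter_spec m w.
Proof.
have one v : all (gtn m.+1) v -> sorted gtn [seq b <- v | m <= b] ->
    all (gtn m) v \/ exists p v', [/\ v = insert p m v', all (gtn m) v' & p <= size v'].
  elim: v => [|b v IH] /=; first by left.
  rewrite ltnS leq_eqVlt => /andP[/predU1P[-> | lt_bm] vm].
    rewrite leqnn /= (path_sortedE gtn_trans) => /andP[/allP vm' _].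
    right; exists 0, v; rewrite insert0; split=> //; apply/allP => c cv /=.
    rewrite ltnNge; apply/negP => le_mc.
    by have := vm' c; rewrite mem_filter le_mc cv /= ltnNge le_mc => /(_ isT).
  rewrite leqNgt lt_bm /= => /(IH vm)[v0|[p [v' [-> v'm le_p]]]].
    by left; rewrite v0.
  right.
  by exists p.+1, (b :: v'); rewrite insert_cons /= lt_bm.
elim: w => [|a w IH]; first by constructor 1.
move=> /= /andP[le_am wm] /andP[sw /(IH wm) {}IH].
move: le_am; rewrite ltnS leq_eqVlt => /predU1P[eam | lt_am].
  move: sw; rewrite eam => /(one w wm)[w0 | [p [v [-> vm le_p]]]].
    by apply: (OneMax (p := 0) (w' := w)); rewrite ?insert0.
  exact: TwoMax vm le_p.
case: IH => [w0|p v ew vm le_p|p v ew vm le_p].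
- by apply: NoMax; rewrite /= lt_am.
- by apply: (OneMax (p := p.+1) (w' := a :: v)); rewrite ?insert_cons ?ew /= ?lt_am.
- move: sw; rewrite ew /= (ltnW lt_am) /= (path_sortedE gtn_trans).
  case/andP=> /allP/(_ m); rewrite mem_filter (ltnW lt_am) /insert mem_cat inE eqxx.
  by rewrite orbT /= ltnn => /(_ isT).
Qed.

Lemma mem_insert1P m ws w :
  reflect (exists v p, [/\ v \in ws, p <= dec_run v & w = insert p m v])
          (w \in insert1 m ws).
Proof.
apply: (iffP allpairsPdep) => -[v [p [vw + ->]]].
  by rewrite mem_index_iota leq0n ltnS => le_p; exists v, p.
by move=> le_p; exists v, p; rewrite mem_index_iota leq0n ltnS.
Qed.

Lemma mem_insert2P m ws w :
  reflect (exists v p, [/\ v \in ws, p <= dec_run v & w = m :: insert p m v])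
          (w \in insert2 m ws).
Proof.
apply: (iffP allpairsPdep) => -[v [p [vw + ->]]].
  by rewrite mem_index_iota leq0n ltnS => le_p; exists v, p.
by move=> le_p; exists v, p; rewrite mem_index_iota leq0n ltnS.
Qed.

Definition parking m w := all (fun k => k <= count (gtn k) w) (iota 0 m.+1).

(** The condition at k = m + 1 counts all letters, and there are more than m of them. *)
Lemma parkingS m w : all (gtn m.+1) w -> m < size w ->
  parking m.+1 w = parking m w.
Proof.
move=> wm lt_m; rewrite /parking -addn1 iotaD all_cat /= andbT.
rewrite (_ : _ <= count _ _); first by rewrite andbT.
by move: wm; rewrite add0n all_count => /eqP ->.
Qed.

Lemma parking_insert m p w : parking m (insert p m w) = parking m w.
Proof.
apply: eq_in_all => k; rewrite mem_iota add0n ltnS => /andP[_ le_k].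
by rewrite count_insert /= ltnNge le_k.
Qed.

Lemma parking_cons m w : parking m (m :: w) = parking m w.
Proof. by rewrite -insert0 parking_insert. Qed.

(** Deleting the copies of the largest letter inverts the construction, and the parking conditions
    up to [m] do not see that letter. *)
Lemma mem_words m h w :
  (w \in words m h) = [&& size w == m + h, all (gtn m) w, avoids w & parking m w].
Proof.
elim: m h w => [|m IH] h w.
  case: h => [|h]; case: w => [|a w] //=.
  by rewrite andbF.
have all_leq v : all (gtn m) v -> all (gtn m.+1) v.
  by apply: sub_all => b /= lt_bm; apply: ltnW.
rewrite /= !mem_cat IH; apply/idP/idP.
  case/or3P.
  - case/and4P=> /eqP sw wm av pw; rewrite sw addnS eqxx all_leq //= av.
    by rewrite parkingS ?all_leq // sw addnS ltnS leq_addr.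
  - case/mem_insert1P=> v [p [+ le_p ->]]; rewrite IH => /and4P[/eqP sv vm av pv].
    have le_s := leq_trans le_p (dec_run_size v).
    have vm1 : all (gtn m.+1) (insert p m v) by rewrite all_insert /= ltnSn all_leq.
    rewrite parkingS // size_insert sv ?ltnS ?leq_addr // vm1.
    by rewrite addSn eqxx parking_insert pv avoids_insert ?av ?le_p.
  - case: h => // h; case/mem_insert2P=> v [p [+ le_p ->]].
    rewrite IH => /and4P[/eqP sv vm av pv].
    have le_s := leq_trans le_p (dec_run_size v).
    have vm1 : all (gtn m.+1) (m :: insert p m v).
      by rewrite /= all_insert /= ltnSn all_leq.
    rewrite parkingS //; last by rewrite /= size_insert sv; lia.
    rewrite [size _]/= size_insert sv vm1.
    rewrite parking_cons parking_insert pv avoids_cons_insert // avoids_insert //.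
    by rewrite av le_p !andbT; apply/eqP; lia.
case/and4P=> /eqP sw wm av pw.
have {}pw : parking m w by rewrite -parkingS ?sw //; lia.
have ML := max_letterP wm av.
case: ML sw wm av pw => [w0|p v -> vm le_p|p v -> vm le_p].
- by move=> -> _ -> ->; rewrite w0 addnS addSn eqxx.
- rewrite size_insert avoids_insert // parking_insert.
  move=> sv _ /andP[le_pr av] pv; apply/or3P/Or32.
  apply/mem_insert1P; exists v, p; rewrite le_pr IH vm av pv.
  by split=> //; rewrite !andbT; apply/eqP; lia.
- rewrite avoids_cons_insert // avoids_insert // parking_cons parking_insert.
  rewrite [size _]/= size_insert => sv _ /andP[le_pr av] pv; apply/or3P/Or33.
  (* The parking condition at k = m bounds the size of [v] from below, which excludes [h = 0]. *)
  have: m <= count (gtn m) v.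
    by move/allP: (pv) => /(_ m); rewrite mem_iota add0n ltnSn; apply.
  move: (vm); rewrite all_count => /eqP -> le_mv.
  case: h sv => [|h] sv; first by lia.
  apply/mem_insert2P; exists v, p; rewrite le_pr IH vm av pv.
  by split=> //; rewrite !andbT; apply/eqP; lia.
Qed.

Lemma words_all m h w : w \in words m h -> all (gtn m) w.
Proof. by rewrite mem_words => /and4P[]. Qed.

Lemma insert_inj m p p' w w' : all (gtn m) w -> all (gtn m) w' ->
  p <= size w -> p' <= size w' -> insert p m w = insert p' m w' ->
  w = w' /\ p = p'.
Proof.
move=> wm wm' le_p le_p' e.
split; first by rewrite -(filter_insert p wm) e filter_insert.
by rewrite -(index_insert wm le_p) e index_insert.
Qed.

Lemma uniq_insert1 m ws :
  uniq ws -> all (all (gtn m)) ws -> uniq (insert1 m ws).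
Proof.
move=> uws /allP wsm; apply: allpairs_uniq_dep => // [w _|]; first exact: iota_uniq.
move=> _ _ /allpairsPdep[v [p [vw + ->]]] /allpairsPdep[v' [p' [vw' + ->]]] /=.
rewrite !mem_index_iota !ltnS /= => le_p le_p' /insert_inj[].
- exact: wsm.
- exact: wsm.
- exact: leq_trans le_p (dec_run_size v).
- exact: leq_trans le_p' (dec_run_size v').
- by move=> -> ->.
Qed.

Lemma insert2E m ws : insert2 m ws = map (cons m) (insert1 m ws).
Proof.
by rewrite /insert1 /insert2 map_allpairs.
Qed.

(** The three sublists are told apart by the number of occurrences of [m]. *)
Lemma uniq_words m h : uniq (words m h).
Proof.
elim: m h => [|m IH] h; first by case: h.
have cnt0 h' w : w \in words m h' -> count_mem m w = 0.
  move/words_all/allP => wm; apply/eqP; rewrite -leqn0 leqNgt -has_count.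
  by apply/hasPn => b /wm /=; case: ltngtP.
rewrite /= !cat_uniq IH /=; apply/and4P; split.
- apply/hasPn => w; rewrite mem_cat => /orP[/mem_insert1P[v [p [vw _ ->]]]|].
    by apply/negP => /cnt0; rewrite count_insert /= eqxx.
  case: h => // h /mem_insert2P[v [p [vw _ ->]]].
  by apply/negP => /cnt0; rewrite /= count_insert /= eqxx.
- by rewrite uniq_insert1 //; apply/allP => w /words_all.
- apply/hasPn => w; case: h => // h /mem_insert2P[v [p [vw _ ->]]].
  apply/negP => /mem_insert1P[v' [p' [vw' _]]] /(congr1 (count_mem m)).
  by rewrite /= !count_insert /= (cnt0 _ _ vw) (cnt0 _ _ vw') eqxx.
- case: h => // h; rewrite insert2E map_inj_uniq => [|u v []] //.
  by rewrite uniq_insert1 //; apply/allP => w /words_all.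
Qed.

Lemma sum_words (R : nmodType) (F : seq nat -> R) m h :
  (\sum_(w <- words m.+1 h) F w =
   \sum_(w <- words m h.+1) F w
   + \sum_(w <- words m h) \sum_(0 <= p < (dec_run w).+1) F (insert p m w)
   + if h is h'.+1 then
       \sum_(w <- words m h') \sum_(0 <= p < (dec_run w).+1) F (m :: insert p m w)
     else 0)%R.
Proof.
rewrite /= !big_cat /= addrA; congr (_ + _ + _)%R.
  by rewrite /insert1 big_allpairs_dep.
by case: h => [|h]; rewrite ?big_nil // /insert2 big_allpairs_dep.
Qed.

(** The recursion fixes the first letter [a] of a pattern: the later letters that are at least [a]
    must contain no weakly increasing pair. *)
Lemma avoidsP w :
  reflect (forall i j l, i < j < l -> l < size w ->
             ~~ (nth 0 w i <= nth 0 w j <= nth 0 w l))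
          (avoids w).
Proof.
elim: w => [|a w IH] /=; first by left.
have -> : sorted gtn [seq b <- w | a <= b] =
    pairwise (fun b c => ~~ (a <= b <= c)) w.
  rewrite (sorted_pairwise gtn_trans).
  elim: w {IH} => //= b w <-; case: leqP => [le_ab|lt_ba] /=.
    congr (_ && _); rewrite all_filter; apply: eq_all => c /=.
    by rewrite -ltnNge; case: ltngtP => //= ?; rewrite ?implybT // ?implybF; lia.
  by rewrite (introT allP).
apply: (iffP andP) => [[/(pairwiseP 0) pw /IH av] i [|j] [|l] ijl sl|av]; try lia.
  case: i ijl => [|i] ijl; first by apply: pw; rewrite ?inE; lia.
  by apply: av => //; lia.
split.
  by apply/(pairwiseP 0) => j l; rewrite !inE => ? ? ?; apply: (av 0 j.+1 l.+1); lia.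
by apply/IH => i j l ijl sl; apply: (av i.+1 j.+1 l.+1); lia.
Qed.

Lemma nb_asc_count w : nb_asc w =
  count (fun i => (i.+1 < size w) && (nth 0 w i <= nth 0 w i.+1))
        (iota 0 (size w)).
Proof.
elim: w => // a w IH; rewrite [size _]/= -add1n iotaD count_cat add0n.
rewrite (iotaDl 1 0) count_map -[nb_asc _]/(_ + nb_asc w) IH; congr (_ + _).
by case: w {IH} => //= b w; rewrite addn0.
Qed.

(** * Functions as words *)

Definition word_of n (f : {ffun 'I_n -> 'I_n}) : seq nat :=
  [seq val (f i) | i <- enum 'I_n].

Lemma size_word_of n (f : {ffun 'I_n -> 'I_n}) : size (word_of f) = n.
Proof. by rewrite size_map size_enum_ord. Qed.

Lemma nth_word_of n (f : {ffun 'I_n -> 'I_n}) (i : 'I_n) :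
  nth 0 (word_of f) i = f i.
Proof. by rewrite (nth_map i) ?size_enum_ord // nth_ord_enum. Qed.

Lemma word_of_inj n : injective (@word_of n).
Proof.
move=> f g e; apply/ffunP => i; apply: val_inj.
by rewrite /= -!nth_word_of e.
Qed.

Lemma all_word_of n (f : {ffun 'I_n -> 'I_n}) : all (gtn n) (word_of f).
Proof. by apply/allP => _ /mapP[i _ ->] /=. Qed.

Lemma word_of_surj n w : size w = n -> all (gtn n) w -> exists f, w = @word_of n f.
Proof.
move=> sw /allP wn; exists [ffun i : 'I_n => insubd i (nth 0 w i)].
apply: (@eq_from_nth _ 0); first by rewrite size_word_of.
move=> i; rewrite sw => lt_in; rewrite (nth_word_of _ (Ordinal lt_in)) ffunE.
rewrite val_insubd /= ifT //.
by apply: wn; rewrite mem_nth // sw.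
Qed.

Lemma card_set_count n (P : pred 'I_n) : #|[set i | P i]| = count P (enum 'I_n).
Proof. by rewrite cardsE cardE enumT -size_filter. Qed.

Lemma parking_word_of n (f : {ffun 'I_n -> 'I_n}) :
  parking n (word_of f) = is_parking f.
Proof.
have cnt k : count (gtn k) (word_of f) = #|[set i | f i < k]|.
  by rewrite card_set_count count_map.
apply/allP/forallP => [pf k | pf k].
  by apply/implyP => _; rewrite -cnt pf // mem_iota ltn_ord.
rewrite mem_iota ltnS => /andP[_ le_kn]; rewrite cnt.
case: k le_kn => // k lt_kn.
by have := pf (Ordinal (lt_kn : k.+1 < n.+1)).
Qed.

Lemma avoids_word_of n (f : {ffun 'I_n -> 'I_n}) :
  avoids (word_of f) = avoids123 f.
Proof.
apply/avoidsP/idP => [av | /negP av i j l ijl].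
  apply/negP => /existsP[i /existsP[j /existsP[l /and4P[ij jl le1 le2]]]].
  have := av i j l; rewrite ij jl size_word_of ltn_ord !nth_word_of le1 le2.
  by move=> /(_ isT isT).
rewrite size_word_of => lt_ln; apply/negP => le2; case: av.
have lt_jn : j < n by lia.
have lt_in : i < n by lia.
apply/existsP; exists (Ordinal lt_in); apply/existsP; exists (Ordinal lt_jn).
apply/existsP; exists (Ordinal lt_ln).
by rewrite -!nth_word_of /= andbA le2 ijl.
Qed.

Lemma nb_asc_word_of n (f : {ffun 'I_n -> 'I_n}) :
  nb_asc (word_of f) = #|ascents f|.
Proof.
rewrite nb_asc_count size_word_of -val_enum_ord count_map card_set_count.
apply: eq_count => i /=; apply/andP/existsP => [[lt_i le_f] | [j /andP[/eqP ej le_f]]].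
  by exists (Ordinal lt_i); rewrite eqxx -!nth_word_of.
by rewrite -ej ltn_ord !nth_word_of.
Qed.

Lemma card_parking_words n k :
  #|[set f : {ffun 'I_n -> 'I_n} |
      [&& is_parking f, avoids123 f & #|ascents f| == k]]| =
  count (fun w => nb_asc w == k) (words n 0).
Proof.
rewrite cardE -(size_map (@word_of n)) -size_filter; apply: perm_size.
apply: uniq_perm.
- by rewrite map_inj_uniq ?enum_uniq //; apply: word_of_inj.
- by rewrite filter_uniq ?uniq_words.
move=> w; rewrite mem_filter mem_words addn0; apply/mapP/idP => [[f + ->]|].
  rewrite mem_enum inE => /and3P[pf af ef].
  rewrite nb_asc_word_of ef size_word_of eqxx all_word_of.
  by rewrite avoids_word_of af parking_word_of.
case/and5P=> /= kw /eqP/word_of_surj sw /sw[f ew] af pf; exists f => //.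
by rewrite mem_enum inE -parking_word_of -avoids_word_of -nb_asc_word_of -ew pf af.
Qed.

End ParkingWords.

(** * Motzkin polynomials and their Schur coefficients *)

Section Motzkin.
Local Open Scope ring_scope.

(* Motzkin paths of length m from height 0 to height h, where a level step has
   weight b and an up step weight c. *)
Fixpoint motzkin (R : comPzRingType) (b c : R) m h : R :=
  if m is m'.+1 then
    motzkin b c m' h.+1 + b * motzkin b c m' h
    + (if h is h'.+1 then c * motzkin b c m' h' else 0)
  else (h == 0%N)%:R.

(* Last passage decomposition. *)
Lemma motzkin_succ (R : comPzRingType) (b c : R) m h :
  motzkin b c m h.+1 =
  c * \sum_(0 <= i < m) motzkin b c i h * motzkin b c (m - i.+1) 0.
Proof.
elim: m h => [|m IH] h; first by rewrite big_geq // mulr0.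
rewrite big_nat_recl // subn1 /=.
under eq_bigr => i _ do rewrite subSS !mulrDl -mulrA.
rewrite !big_split /= -big_distrr /= !mulrDr -IH.
rewrite [c * (b * _)]mulrCA -IH.
case: h => [|h].
  rewrite eqxx mul1r [in X in _ + (_ + X)]big1 ?mulr0 ?addr0 => [|i _].
    by rewrite addrC.
  by rewrite mul0r.
rewrite mul0r mulr0 add0r; congr (_ + _).
under eq_bigr => i _ do rewrite -mulrA.
by rewrite -big_distrr /= -IH.
Qed.

(** Polynomials in u and v, with u the outer and v the inner variable: the coefficient of u^i v^j is
    the j-th coefficient of the i-th one. *)
Local Notation bipoly := {poly {poly int}}.
Local Notation U := ('X : bipoly).
Local Notation V := ('X%:P : bipoly).
Implicit Types (f g : bipoly) (e i j k : nat).

Lemma coefUM f i j : (U * f)`_i`_j = if i is i'.+1 then f`_i'`_j else 0.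
Proof. by rewrite coefXM; case: i => //=; rewrite coef0. Qed.

Lemma coefVM f i j : (V * f)`_i`_j = if j is j'.+1 then f`_i`_j' else 0.
Proof. by rewrite coefCM coefXM; case: j. Qed.

Lemma coef2D f g i j : (f + g)`_i`_j = f`_i`_j + g`_i`_j.
Proof. by rewrite !coefD. Qed.

Lemma coef2N f i j : (- f)`_i`_j = - f`_i`_j.
Proof. by rewrite !coefN. Qed.

Definition coef2E := (coefUM, coefVM, coef2D, coef2N).

Definition level : bipoly := 2 - U - V.
(** This is (1 - u)(1 - v), written to exhibit its difference uv - 1 from [level]; in
    [sum_weight_cons_insert] a double insertion differs from a single one by ['X - 1]. *)
Definition updown : bipoly := level - 1 + U * V.
Definition motz m h := motzkin level updown m h.

Lemma levelM f : level * f = f + f - U * f - V * f.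
Proof. by rewrite /level; ring. Qed.

Lemma updownM f : updown * f = level * f - f + U * (V * f).
Proof. by rewrite /updown; ring. Qed.

Definition symmetric2 f := forall i j, f`_i`_j = f`_j`_i.

Lemma symmetric2_level f : symmetric2 f -> symmetric2 (level * f).
Proof.
move=> sf i j; rewrite levelM !coef2E (sf i j).
case: i j => [|i] [|j]; rewrite ?coef2E //.
- by rewrite (sf 0 j); ring.
- by rewrite (sf i 0); ring.
- by rewrite (sf i j.+1) (sf i.+1 j); ring.
Qed.

Lemma symmetric2_motz m h : symmetric2 (motz m h).
Proof.
rewrite /motz; elim: m h => [|m IH] h i j /=.
  by rewrite -!polyC_natr !coefC; case: i j => [|i] [|j]; rewrite ?coefC ?coef0.
rewrite !coef2E IH (symmetric2_level (IH h)); congr (_ + _).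
case: h => [|h]; first by rewrite !coef0.
rewrite updownM !coef2E (symmetric2_level (IH h)) IH; congr (_ + _).
by case: i j => [|i] [|j]; rewrite ?coefVM //; apply: IH.
Qed.

(** Every step weight has degree at most 1 in v. *)
Lemma coef_motz_gt m h i j : (m < j)%N -> (motz m h)`_i`_j = 0.
Proof.
rewrite /motz; elim: m h i j => [|m IH] h i [|j] //= lt_mj.
  by rewrite -polyC_natr coefC; case: i => [|i]; rewrite ?coef0 // -polyC_natr coefC.
rewrite ltnS in lt_mj; have lt_mj' : (m < j.+1)%N by lia.
have lev h' i' : (level * motzkin level updown m h')`_i'`_j.+1 = 0.
  by rewrite levelM !coef2E !IH //; case: i' => [|i']; rewrite ?IH //; ring.
rewrite !coef2E lev IH // !add0r; case: h => [|h]; first by rewrite !coef0.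
by rewrite updownM !coef2E lev !IH //; case: i => [|i]; rewrite ?coefVM ?IH //; ring.
Qed.

(* For f symmetric, tau e f is the sum over k of m_k x^k where m_k is the
   coefficient of the Schur polynomial s_(k+e,k)(u,v) in f. *)
Definition tau e f : {poly int} :=
  \poly_(k < (size f).+1)
    (f`_k`_(k + e) - (if k is k'.+1 then f`_k'`_(k + e).+1 else 0)).

Lemma coef_tau e f k : (tau e f)`_k =
  f`_k`_(k + e) - (if k is k'.+1 then f`_k'`_(k + e).+1 else 0).
Proof.
rewrite coef_poly; case: ltnP => // le_fk.
case: k le_fk => // k; rewrite ltnS => le_fk.
by rewrite !(nth_default _ le_fk) (nth_default _ (leqW le_fk)) !coef0 subrr.
Qed.

Lemma tauD e f g : tau e (f + g) = tau e f + tau e g.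
Proof.
by apply/polyP => k; rewrite !(coefD, coef_tau); case: k => [|k]; rewrite ?coef2E; ring.
Qed.

Lemma tauN e f : tau e (- f) = - tau e f.
Proof.
by apply/polyP => k; rewrite !(coefN, coef_tau); case: k => [|k]; rewrite ?coef2E; ring.
Qed.

Lemma tau0 e : tau e 0 = 0.
Proof. by apply/polyP => k; rewrite coef_tau; case: k => *; rewrite !coef0 subr0. Qed.

(** Multiplication by uv turns s_(k+e,k) into s_(k+e+1,k+1). *)
Lemma tau_UV e f : tau e (U * (V * f)) = 'X * tau e f.
Proof.
apply/polyP => k; rewrite coefXM !coef_tau.
by case: k => [|[|k]]; rewrite !coefUM ?addSn ?coefVM ?subr0.
Qed.

(** Pieri's rule in two variables: (u + v) s_(k+e,k) = s_(k+e+1,k) + s_(k+e,k+1), where the last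
    term is absent for e = 0. *)
Lemma tau_level e f : symmetric2 f ->
  tau e (level * f) =
  tau e f *+ 2 - (if e is e'.+1 then tau e' f else 0) - 'X * tau e.+1 f.
Proof.
move=> sf; apply/polyP => k.
rewrite levelM !(coefD, coefN, coefMn, coefXM, coef_tau).
case: k => [|k]; rewrite !coef2E ?add0n; case: e => [|e];
  rewrite ?coef_tau ?coef0 ?addn0 ?add0n.
- by rewrite mulr2n; ring.
- by rewrite mulr2n; ring.
(* For [e = 0], symmetry identifies the two coefficients adjacent to the diagonal. *)
- rewrite (sf k.+1 k) /=; case: k => [|k]; rewrite ?addn1 mulr2n; ring.
- rewrite /= !addnS !addSn; case: k => [|k]; rewrite ?addnS ?addSn mulr2n; ring.
Qed.

Lemma tau_updown e f : symmetric2 f ->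
  tau e (updown * f) = tau e (level * f) + ('X - 1) * tau e f.
Proof. by move=> sf; rewrite updownM !tauD tauN tau_UV; ring. Qed.

Lemma tau_motz0 e h : tau e (motz 0 h) = ((h == 0%N) && (e == 0%N))%:R.
Proof.
apply/polyP => k; rewrite coef_tau /motz /= -!polyC_natr !coefC.
by case: h k e => [|h] [|[|k]] [|e]; rewrite ?coefC ?coef0 ?subr0.
Qed.

(** A down, level or up step is an insertion of the letter [m] zero, one or two times. The factor
    (-1)^e x^(e+1) turns the recursion of [tau_level] into that of [sum_weight_dec_insert]. *)
Lemma sum_weight_dec_words e m h :
  \sum_(w <- words m h) weight_dec e w =
  (-1) ^+ e * 'X ^+ e.+1 * tau e (motz m h).
Proof.
elim: m h e => [|m IH] h e.
  rewrite tau_motz0; case: h => [|h] /=; last by rewrite big_nil mulr0.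
  rewrite big_seq1 /weight_dec /weight /psi_ /=.
  by case: e => [|e]; rewrite ?mulr0 ?mulr1 ?mul1r ?expr1.
have S1 h' e' : \sum_(w <- words m h') \sum_(0 <= p < (dec_run w).+1)
      weight_dec e' (insert p m w) =
    (-1) ^+ e' * 'X ^+ e'.+1 * tau e' (level * motz m h').
  rewrite big_seq.
  under eq_bigr => w ww do rewrite sum_weight_dec_insert ?(words_all ww) //.
  rewrite -big_seq !big_split /= !IH tau_level; last exact: symmetric2_motz.
  case: e' => [|e']; first by rewrite big1 // !exprS; ring.
  by rewrite -big_distrr /= IH !exprS; ring.
have S2 h' : \sum_(w <- words m h') \sum_(0 <= p < (dec_run w).+1)
      weight_dec e (m :: insert p m w) =
    (-1) ^+ e * 'X ^+ e.+1 * tau e (updown * motz m h').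
  rewrite big_seq.
  under eq_bigr => w ww do rewrite sum_weight_dec_cons_insert ?(words_all ww) //.
  rewrite -big_seq big_split /= S1 -big_distrr /= IH tau_updown.
    by ring.
  exact: symmetric2_motz.
rewrite sum_words IH S1 /motz /= !tauD; case: h => [|h].
  by rewrite tau0 -/(motz m 1) -/(motz m 0); ring.
by rewrite S2 -!/(motz m _); ring.
Qed.

(** [N] exceeds the degree in v, so the sum over [e] contains all nonzero terms. *)
Lemma sum_weight_asc_words N m h : (m < N)%N ->
  \sum_(w <- words m h) weight_asc w = \sum_(0 <= e < N) tau e (motz m h).
Proof.
elim: m h => [|m IH] h lt_mN.
  case: N lt_mN => // N _; rewrite big_nat_recl // tau_motz0.
  rewrite [X in _ = _ + X]big1 => [|e _]; last by rewrite tau_motz0 andbF.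
  by case: h => [|h]; rewrite /= ?big_nil ?big_seq1 addr0.
have {}IH h' : \sum_(w <- words m h') weight_asc w =
    \sum_(0 <= e < N) tau e (motz m h') by apply: IH; apply: ltnW.
case: N lt_mN IH => // N; rewrite ltnS => lt_mN IH.
have tau_gt h' e : (m < e)%N -> tau e (motz m h') = 0.
  move=> lt_me; apply/polyP => k; rewrite coef_tau coef0 coef_motz_gt ?sub0r; last by lia.
  by case: k => [|k]; rewrite ?oppr0 // coef_motz_gt ?oppr0 //; lia.
(* Both shifted sums in Pieri's rule reproduce the full sum, up to the boundary term [tau 0]; [W0]
   identifies the latter with the [weight_dec 0] of [sum_weight_asc_insert]. *)
have lev h' : \sum_(0 <= e < N.+1) tau e (level * motz m h') =
    (1 - 'X) * \sum_(0 <= e < N.+1) tau e (motz m h') + 'X * tau 0 (motz m h').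
  under eq_bigr do rewrite (tau_level _ (symmetric2_motz m h')).
  set S := (X in (1 - 'X) * X).
  have A : \sum_(0 <= e < N.+1)
      (if e is e'.+1 then tau e' (motz m h') else 0) = S.
    by rewrite big_nat_recl // add0r /S big_nat_recr //= tau_gt ?addr0.
  have B : \sum_(0 <= e < N.+1) tau e.+1 (motz m h') = S - tau 0 (motz m h').
    rewrite big_nat_recr //= tau_gt ?addr0; last by lia.
    by rewrite /S big_nat_recl //= addrC addKr.
  by rewrite !sumrB sumrMnl -big_distrr /= A B -/S; ring.
have W0 h' : \sum_(w <- words m h') weight_dec 0 w = 'X * tau 0 (motz m h').
  by rewrite sum_weight_dec_words mul1r expr1.
have S1 h' : \sum_(w <- words m h') \sum_(0 <= p < (dec_run w).+1)
      weight_asc (insert p m w) =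
    \sum_(0 <= e < N.+1) tau e (level * motz m h').
  rewrite big_seq.
  under eq_bigr => w ww do rewrite sum_weight_asc_insert ?(words_all ww) //.
  by rewrite -big_seq !big_split /= -big_distrr /= IH W0 lev.
have S2 h' : \sum_(w <- words m h') \sum_(0 <= p < (dec_run w).+1)
      weight_asc (m :: insert p m w) =
    \sum_(0 <= e < N.+1) tau e (updown * motz m h').
  rewrite big_seq.
  under eq_bigr => w ww do rewrite sum_weight_asc_cons_insert ?(words_all ww) //.
  rewrite -big_seq big_split /= S1 -big_distrr /= IH.
  under [in RHS]eq_bigr do rewrite (tau_updown _ (symmetric2_motz m h')).
  by rewrite big_split /= -big_distrr.
rewrite sum_words IH S1 /motz /=; under [in RHS]eq_bigr do rewrite !tauD.
rewrite !big_split /=; congr (_ + _); case: h => [|h].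
  by rewrite big1 // => e _; rewrite tau0.
by rewrite S2.
Qed.
End Motzkin.

(** * Sign-reversing involutions *)

Section Toggle.
Variable X : finType.
Implicit Types (T : {set X}) (r : X).

Definition toggle r T := if r \in T then T :\ r else r |: T.

Lemma toggleK r T : toggle r (toggle r T) = T.
Proof.
rewrite /toggle; case: (boolP (r \in T)) => rT; rewrite ?setD11 ?setU11.
  exact: setD1K.
exact: setU1K.
Qed.

Lemma in_toggle r T p : p != r -> (p \in toggle r T) = (p \in T).
Proof. by rewrite /toggle => /negbTE pr; case: ifP; rewrite !inE pr. Qed.

Lemma sign_toggle r T : ((-1) ^+ #|toggle r T| = - (-1) ^+ #|T| :> int)%R.
Proof.
rewrite /toggle; case: (boolP (r \in T)) => rT.
  by rewrite [in RHS](cardsD1 r) rT exprS mulN1r opprK.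
by rewrite cardsU1 rT exprS mulN1r.
Qed.

(** As the choice [r T] survives the toggle, toggling is an involution on [P]; it reverses signs, so
    the sum equals its negative. *)
Lemma sum_sign_toggle (P : pred {set X}) (r : {set X} -> X) :
  (forall T, P T -> P (toggle (r T) T)) ->
  (forall T, P T -> r (toggle (r T) T) = r T) ->
  (\sum_(T | P T) (-1) ^+ #|T| = 0 :> int)%R.
Proof.
move=> Pt rt; set S : int := (X in X = _).
suff: (S = - S)%R by lia.
rewrite {1}/S (reindex_onto (fun T => toggle (r T) T) (fun T => toggle (r T) T)) /=.
  rewrite -sumrN; apply: eq_big => [T | T _]; last exact: sign_toggle.
  apply/andP/idP => [[PT /eqP e]|PT]; first by rewrite -e; apply: Pt.
  by rewrite Pt // rt // toggleK eqxx.
by move=> T PT; rewrite rt // toggleK.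
Qed.
End Toggle.

(** * Dissections of subpolygons and their cells *)

Section Dissections.
Variable n : nat.
Local Notation vertex := 'I_n.+3.
Local Notation segment := (vertex * vertex)%type.
Implicit Types (a b c d x y : vertex) (p q : segment) (S T : {set segment}).

(** The base a b is allowed: the subpolygon on a, ..., b has its base as an optional segment. *)
Definition within a b p := [&& a <= p.1, p.1.+1 < p.2 & p.2 <= b].

Definition noncrossing T := [forall p in T, forall q in T, ~~ crossing p q].

Definition dissects a b T := [forall p in T, within a b p] && noncrossing T.

Definition joined T x y := (x.+1 == y) || ((x, y) \in T).

Lemma dissectsP a b T :
  reflect ((forall p, p \in T -> within a b p) /\
           (forall p q, p \in T -> q \in T -> ~~ crossing p q))
          (dissects a b T).
Proof.
apply: (iffP andP) => [[/forall_inP inT /forall_inP ncT] | [inT ncT]].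
  split=> // p q pT qT; exact: (forall_inP (ncT p pT)).
split; first by apply/forall_inP.
by apply/forall_inP => p pT; apply/forall_inP => q qT; apply: ncT.
Qed.

Lemma dissects_subset a b S T : S \subset T -> dissects a b T -> dissects a b S.
Proof.
move=> /subsetP sST /dissectsP[inT ncT]; apply/dissectsP.
by split=> [p /sST/inT // | p q /sST pT /sST]; apply: ncT.
Qed.

Lemma is_dissectionE S :
  is_dissection S = dissects ord0 ord_max S && ((ord0, ord_max) \notin S).
Proof.
rewrite /is_dissection /dissects -/(noncrossing S) [RHS]andbAC; congr (_ && _).
apply/forall_inP/andP => [dS | [/forall_inP inS dS] p pS].
  split; last by apply/negP => /dS /andP[_]; rewrite /= eqxx.
  apply/forall_inP => p /dS /andP[lt_p _]; rewrite /within lt_p /=.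
  by rewrite -ltnS ltn_ord.
rewrite /is_diagonal; have /and3P[_ -> _] := inS _ pS.
apply: contraNN dS => /= /andP[/eqP e1 /eqP e2].
rewrite -(_ : p = (ord0, ord_max)) //.
by case: p e1 e2 {pS} => u v /= *; congr pair; apply: val_inj.
Qed.

(** Take the least vertex above [a] joined to [b]; the vertex b - 1 is always a candidate. *)
Lemma exists_split T a b : a.+1 < b ->
  exists x, [/\ a < x, joined T x b & forall y, a < y < x -> ~~ joined T y b].
Proof.
move=> lt_ab; have lt_b1 : b.-1 < n.+3 by apply: leq_ltn_trans (leq_pred b) _.
have P0 : (a < Ordinal lt_b1) && joined T (Ordinal lt_b1) b.
  by rewrite /joined /=; apply/andP; split; [|apply/orP; left]; lia.
case: (@arg_minnP _ (Ordinal lt_b1) (fun x => (a < x) && joined T x b) val P0).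
move=> x /andP[lt_ax Tx] minx; exists x; split=> // y /andP[lt_ay lt_yx].
by apply/negP => Ty; have := minx y; rewrite lt_ay Ty => /(_ isT) /=; lia.
Qed.

Lemma joined_lt T a b x : dissects a b T -> joined T x b -> x < b.
Proof.
case/dissectsP=> inT _ /orP[/eqP <- // | /inT /and3P[_ /= lt _]]; lia.
Qed.

(** A segment passing over [x] would cross x b unless it ends at [b]. Then minimality of [x] forces
    it to start at [a], so it is the excluded base. *)
Lemma split_within T a b x p :
  dissects a b T -> (a, b) \notin T -> a < x -> joined T x b ->
  (forall y, a < y < x -> ~~ joined T y b) -> p \in T ->
  within a x p || within x b p.
Proof.
case/dissectsP=> inT ncT abT lt_ax Tx minx pT.
have /and3P[le1 lt2 le3] := inT p pT; rewrite /within lt2 le1 le3 /= andbT.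
case: leqP => // lt_xp2; rewrite leqNgt; apply/negP => lt_p1x.
have e2 : p.2 = b.
  apply: val_inj => /=; case/orP: Tx => [/eqP ex|xT]; first by lia.
  by have := ncT _ _ pT xT; rewrite /crossing /=; lia.
have ep : p = (p.1, b) by rewrite -e2; case: (p).
have [e1 | ne1] := eqVneq (p.1 : nat) a.
  by move: abT; rewrite -(_ : p = (a, b)) ?pT // ep; congr pair; apply: val_inj.
have /minx : a < p.1 < x by lia.
by rewrite /joined -ep pT orbT.
Qed.

Definition restrict a b T := [set p in T | within a b p].

Lemma dissects_restrict a b c d T : dissects c d T -> dissects a b (restrict a b T).
Proof.
move=> /dissectsP[_ ncT]; apply/dissectsP.
split=> [p|p q]; rewrite !inE; first by case/andP.
by case/andP=> pT _ /andP[qT _]; apply: ncT.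
Qed.

Lemma split_union T a b x :
  dissects a b T -> (a, b) \notin T -> a < x -> joined T x b ->
  (forall y, a < y < x -> ~~ joined T y b) ->
  T = restrict a x T :|: restrict x b T.
Proof.
move=> dT abT lt_ax Tx minx; apply/setP => p; rewrite !inE -andb_orr.
case: (boolP (p \in T)) => //= pT.
by rewrite (split_within dT abT lt_ax Tx minx pT).
Qed.

Lemma card_split_union T1 T2 a b x :
  {in T1, forall p, within a x p} -> {in T2, forall p, within x b p} ->
  #|T1 :|: T2| = #|T1| + #|T2|.
Proof.
move=> in1 in2; rewrite cardsU (_ : T1 :&: T2 = set0) ?cards0 ?subn0 //.
apply/setP => p; rewrite !inE.
by apply/negP => /andP[/in1 /and3P[_ ? ?] /in2 /and3P[? _ _]]; lia.
Qed.

Lemma card_split T a b x :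
  dissects a b T -> (a, b) \notin T -> a < x -> joined T x b ->
  (forall y, a < y < x -> ~~ joined T y b) ->
  #|T| = #|restrict a x T| + #|restrict x b T|.
Proof.
move=> dT abT lt_ax Tx minx.
rewrite {1}(split_union dT abT lt_ax Tx minx).
rewrite (card_split_union (a := a) (x := x) (b := b)) //.
  by move=> p; rewrite inE => /andP[].
by move=> p; rewrite inE => /andP[].
Qed.

(** Remove the base and split at [x]: the two parts hold at most (x - a - 1) + (b - x - 1)
    segments. *)
Lemma card_dissects a b T : a < b -> dissects a b T -> #|T| <= b - a.+1.
Proof.
move En: (b - a) => d; elim/ltn_ind: d a b En T => d IH a b En T lt_ab dT.
have [lt_a1b | le_ba1] := ltnP a.+1 b; last first.
  rewrite (_ : T = set0) ?cards0 //; apply/setP => p; rewrite inE.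
  apply/negP => pT; have [inT _] := dissectsP _ _ _ dT.
  by have := inT p pT; rewrite /within; lia.
have dT' : dissects a b (T :\ (a, b)) := dissects_subset (subD1set _ _) dT.
have abT' : (a, b) \notin T :\ (a, b) by rewrite setD11.
have [x [lt_ax Tx minx]] := exists_split (T :\ (a, b)) lt_a1b.
have lt_xb := joined_lt dT' Tx.
have := card_split dT' abT' lt_ax Tx minx.
have c1 := IH (x - a) ltac:(lia) a x erefl _ lt_ax (dissects_restrict a x dT').
have c2 := IH (b - x) ltac:(lia) x b erefl _ lt_xb (dissects_restrict x b dT').
rewrite (cardsD1 (a, b) T) => ->; move: c1 c2; clear -lt_ax lt_xb lt_a1b.
by move: #|restrict a x _| #|restrict x b _|; case: (_ \in T) => /= i j; lia.
Qed.

Lemma noncrossing_within a b p : within a b p -> ~~ crossing p (a, b).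
Proof. by rewrite /within /crossing /=; lia. Qed.

Lemma crossingC p q : crossing p q = crossing q p.
Proof. by rewrite /crossing orbC. Qed.

Lemma crossing_self p : crossing p p = false.
Proof. by rewrite /crossing; lia. Qed.

Lemma dissects_setU1 a b T : a.+1 < b -> dissects a b T ->
  dissects a b ((a, b) |: T).
Proof.
move=> lt_ab /dissectsP[inT ncT].
apply/dissectsP; split=> [p /setU1P[->|/inT //]|p q].
  by rewrite /within /= !leqnn lt_ab.
move=> /setU1P[-> | pT] /setU1P[-> | qT].
- by rewrite crossing_self.
- by rewrite crossingC noncrossing_within ?inT.
- by rewrite noncrossing_within ?inT.
- exact: ncT.
Qed.

(* The cell of T just below the edge a b has x b as its last other side and has
   at least four sides, so that it is cut by the diagonal a x. *)
Definition refinable T c d a x b :=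
  [/\ (a, b) = (c, d) \/ (a, b) \in T, a < x < b, joined T x b,
      forall y, a < y < x -> ~~ joined T y b & ~~ joined T a x].

(** Either the cell below the base c d has at least four sides, or c x is joined. In the second case
    one of the two parts has fewer segments than its maximum, and the search continues there. *)
Lemma exists_refinable c d T :
  c.+1 < d -> dissects c d T -> (c, d) \notin T -> #|T| < d - c.+2 ->
  exists a x b, refinable T c d a x b.
Proof.
move En: (d - c) => m; elim/ltn_ind: m c d En T => m IH c d En T lt_cd dT cdT cT.
have [x [lt_cx Tx minx]] := exists_split T lt_cd.
have lt_xd := joined_lt dT Tx.
have [Tcx | nTcx] := boolP (joined T c x); last first.
  by exists c, x, d; split=> //; [left | rewrite lt_cx].
have rec (c' d' : vertex) : c <= c' -> d' <= d -> d' - c' < m ->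
    #|restrict c' d' T| < d' - c'.+1 -> joined T c' d' ->
    exists a y b, refinable T c d a y b.
  move=> le_cc' le_dd' lt_m lt_card Tcd'.
  have Tcd : (c', d') \in T.
    by case/orP: Tcd' => [/eqP e|//]; move: lt_card; rewrite e subnn.
  (* The base of the part lies in [T] and is removed to meet the hypotheses of the induction. *)
  pose T' := restrict c' d' T :\ (c', d').
  have lt_cd' : c'.+1 < d' by clear -lt_card; lia.
  have dT' : dissects c' d' T'.
    exact: dissects_subset (subD1set _ _) (dissects_restrict c' d' dT).
  have cdT' : (c', d') \notin T' by rewrite setD11.
  have cardT' : #|T'| < d' - c'.+2.
    move: lt_card; rewrite (cardsD1 (c', d')) inE Tcd /within /= !leqnn lt_cd' /=.
    by rewrite -/T'; move: #|T'| => k; clear; lia.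
  have [a [y [b [ab axb Tyb miny nTay]]]] :=
    IH _ lt_m c' d' erefl T' lt_cd' dT' cdT' cardT'.
  have [le_c'a le_bd'] : c' <= a /\ b <= d'.
    by case: ab => [[-> ->] // |]; rewrite !inE => /and3P[_ _ /and3P[/= ? _ ?]].
  have sub (u v : vertex) : joined T' u v -> joined T u v.
    by rewrite /joined !inE => /orP[-> //|/and3P[_ -> _]]; rewrite orbT.
  have eqj (u v : vertex) : c' <= u -> v <= d' -> (c' < u) || (v < d') ->
      joined T u v -> joined T' u v.
    move=> le1 le2 lt3 /orP[e|uvT]; first by rewrite /joined e.
    rewrite /joined !inE uvT /within /= le1 le2 !andbT.
    have [inT _] := dissectsP _ _ _ dT; have /and3P[_ /= -> _] := inT _ uvT.
    rewrite andbT; apply/orP; right; apply/eqP => -[e1 e2].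
    by move: lt3; rewrite e1 e2 !ltnn.
  exists a, y, b; split=> //.
  - case: ab => [->|]; first by right.
    by rewrite !inE => /and3P[_ abT _]; right.
  - exact: sub.
  - move=> z zP; apply: contraNN (miny z zP) => /eqj.
    by apply; clear -zP axb le_c'a le_bd'; lia.
  - apply: contraNN nTay => /eqj.
    by apply; clear -axb le_c'a le_bd'; lia.
have := card_split dT cdT lt_cx Tx minx => eT.
have [lt1 | le1] := ltnP #|restrict c x T| (x - c.+1).
  by apply: (rec c x) => //; lia.
by apply: (rec x d) => //; lia.
Qed.

(** * Refining a dissection, and Euler's relation *)

Lemma is_dissectionP S :
  reflect ((forall p, p \in S -> is_diagonal p) /\
           (forall p q, p \in S -> q \in S -> ~~ crossing p q))
          (is_dissection S).
Proof.
apply: (iffP andP) => [[/forall_inP diagS /forall_inP ncS] | [diagS ncS]].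
  by split=> // p q pS qS; apply: (forall_inP (ncS p pS)).
split; first by apply/forall_inP.
by apply/forall_inP => p pS; apply/forall_inP => q qS; apply: ncS.
Qed.

Lemma is_dissection_subset S T : S \subset T -> is_dissection T -> is_dissection S.
Proof.
move=> /subsetP sST /is_dissectionP[diagT ncT]; apply/is_dissectionP.
by split=> [p /sST/diagT // | p q /sST pT /sST]; apply: ncT.
Qed.

Lemma is_dissection_setU1 S q : is_dissection S -> is_diagonal q ->
  (forall p, p \in S -> ~~ crossing p q) -> is_dissection (q |: S).
Proof.
move=> /is_dissectionP[diagS ncS] dq ncq; apply/is_dissectionP; split.
  by move=> p /setU1P[-> // | /diagS].
move=> p r /setU1P[-> | pS] /setU1P[-> | rS].
- by rewrite crossing_self.
- by rewrite crossingC ncq.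
- exact: ncq.
- exact: ncS.
Qed.

Lemma noncrossing_outer T a b p : is_dissection T ->
  (a, b) = (ord0, ord_max) \/ (a, b) \in T -> p \in T -> ~~ crossing p (a, b).
Proof.
move=> /is_dissectionP[_ ncT] [[-> ->] pT | abT pT]; last exact: ncT.
by rewrite /crossing /=; have := ltn_ord p.2; lia.
Qed.

Lemma noncrossing_joined T x y p : is_dissection T ->
  joined T x y -> p \in T -> ~~ crossing p (x, y).
Proof.
move=> /is_dissectionP[_ ncT] /orP[/eqP e|xyT] pT; last exact: ncT.
by rewrite /crossing /=; lia.
Qed.

Lemma pair_eq a b p : p.1 = a :> nat -> p.2 = b :> nat -> p = (a, b).
Proof. by case: p => u v /= e1 e2; congr pair; apply: val_inj. Qed.

Lemma refinable_diagonal S a x b :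
  refinable S ord0 ord_max a x b -> is_diagonal (a, x).
Proof.
case=> _ axb _ _ /norP[/eqP ne _]; rewrite /is_diagonal /=.
by have := ltn_ord b; lia.
Qed.

(** A segment that crosses a x but neither a b nor x b joins [b] to a vertex strictly between [a]
    and [x], against the minimality of [x]. *)
Lemma refinable_dissection S a x b : is_dissection S ->
  refinable S ord0 ord_max a x b -> is_dissection ((a, x) |: S).
Proof.
move=> dS ref; apply: is_dissection_setU1 => // [|p pS].
  exact: refinable_diagonal ref.
have [ab axb Sxb minx nSax] := ref.
have nc_ab := noncrossing_outer dS ab pS.
have nc_xb := noncrossing_joined dS Sxb pS.
apply/negP => cr.
have [lt1 e2] : a < p.1 < x /\ p.2 = b :> nat.
  have ex : x.+1 = b \/ x.+1 < b by lia.
  by move: nc_ab nc_xb cr; rewrite /crossing /=; lia.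
have := minx _ lt1; rewrite /joined -(pair_eq (a := p.1) (b := b) erefl e2).
by rewrite pS orbT.
Qed.

Definition last_joined T a b : vertex :=
  [arg max_(y > inord a.+1 | joined T a y && (y < b)) val y].

Lemma last_joinedP T a b : a.+1 < b ->
  [/\ joined T a (last_joined T a b), last_joined T a b < b &
      forall y, joined T a y -> y < b -> y <= last_joined T a b].
Proof.
move=> lt_ab; rewrite /last_joined; case: arg_maxnP => /= [|y /andP[Ty lt_y] maxy].
  have lt_a1 : a.+1 < n.+3 by apply: ltn_trans (ltn_ord b).
  by rewrite /joined inordK // eqxx.
by split=> // z Tz lt_z; apply: maxy; rewrite Tz.
Qed.

Lemma eq_last_joined S T a b : a.+1 < b ->
  (forall y, joined S a y = joined T a y) -> last_joined S a b = last_joined T a b.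
Proof.
move=> lt_ab eqST; have [Sy lt_y maxS] := last_joinedP S lt_ab.
have [Tz lt_z maxT] := last_joinedP T lt_ab.
by apply/val_inj/eqP; rewrite eqn_leq maxT -?eqST // maxS ?eqST.
Qed.

(* The involution toggles the diagonal joining b to the last neighbour of a
   before b; it fixes S because x is minimal in the definition of refinable. *)
Lemma refinable_sum_sign S a x b : is_dissection S ->
  refinable S ord0 ord_max a x b ->
  (\sum_(T | [&& is_dissection T, S \subset T & (a, x) \notin T])
     (-1) ^+ #|T| = 0 :> int)%R.
Proof.
move=> dS [ab axb Sxb minx nSax].
have lt_ab : a.+1 < b by lia.
have ne_ax : x <> a.+1 :> nat.
  by move=> e; move: nSax; rewrite /joined e eqxx.
pose P T := [&& is_dissection T, S \subset T & (a, x) \notin T].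
have joinedS T : S \subset T -> forall u v, joined S u v -> joined T u v.
  by move=> /subsetP sST u v /orP[e|/sST uvT]; rewrite /joined ?e ?uvT ?orbT.
(* A neighbour of [a] beyond [x] would cross x b, and [x] itself is excluded by [P]. *)
have yP T : P T -> a < last_joined T a b < x.
  case/and3P=> dT sST axT; have [Ty lt_y _] := last_joinedP T lt_ab.
  set y := last_joined T a b in Ty lt_y *.
  have lt_ay : a < y.
    have /is_dissectionP[diagT _] := dT.
    case/orP: Ty => [/eqP <- // | /diagT /andP[/= lt _]]; exact: ltnW.
  rewrite lt_ay ltnNge leq_eqVlt; apply/norP; split.
    apply/eqP => /val_inj exy.
    case/orP: Ty => [/eqP e|]; first by case: ne_ax; rewrite exy e.
    by rewrite -exy (negbTE axT).
  apply/negP => lt_xy; case/orP: Ty => [/eqP e|yT]; first by lia.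
  have := noncrossing_joined dT (joinedS _ sST _ _ Sxb) yT.
  by rewrite /crossing /=; lia.
pose r T : segment := (last_joined T a b, b).
have rE T u : P T -> joined (toggle (r T) T) a u = joined T a u.
  move=> PT; rewrite /joined in_toggle // /r; apply/eqP => -[e _].
  by have := yP T PT; rewrite -e ltnn.
apply: (sum_sign_toggle (r := r)) => T PT; last first.
  by congr pair; apply: eq_last_joined => // u; apply: rE.
have /andP[lt_ay lt_yx] := yP T PT; have [Ty lt_y maxy] := last_joinedP T lt_ab.
have /and3P[dT sST axT] := PT.
have rS : r T \notin S.
  have := minx (last_joined T a b); rewrite lt_ay lt_yx => /(_ isT).
  by case/norP.
have axr : (a, x) != r T.
  by apply/eqP => -[e _]; move: lt_ay; rewrite -e ltnn.
apply/and3P; split; last by rewrite in_toggle.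
  rewrite /toggle; case: ifP => rT; first exact: is_dissection_subset (subD1set _ _) dT.
  apply: is_dissection_setU1 => // [|p pT].
    by rewrite /is_diagonal /=; clear -lt_ay lt_yx axb; lia.
  have nc_ab : ~~ crossing p (a, b).
    apply: noncrossing_outer dT _ pT; case: ab => [-> | abS]; [by left | right].
    exact: (subsetP sST).
  have nc_ay := noncrossing_joined dT Ty pT.
  apply/negP => cr.
  (* A segment crossing the toggled one, but neither a b nor the segment to the last neighbour,
     leads from [a] to a later neighbour. *)
  have [ep lt] : p.1 = a :> nat /\ last_joined T a b < p.2 < b.
    move: nc_ab nc_ay cr; rewrite /crossing /r /=.
    by clear -lt_ay lt_yx axb; lia.
  have := maxy p.2; rewrite /joined -(pair_eq (a := a) (b := p.2) ep erefl) pT orbT.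
  by move=> /(_ isT); clear -lt; lia.
apply/subsetP => p pS; rewrite in_toggle ?(subsetP sST) //.
by apply: contraNneq rS => <-.
Qed.

Lemma card_dissection S : is_dissection S -> #|S| <= n.
Proof.
rewrite is_dissectionE => /andP[dS S0].
have dS' := dissects_setU1 (isT : (ord0 : vertex).+1 < (ord_max : vertex)) dS.
have := card_dissects (isT : (ord0 : vertex) < (ord_max : vertex)) dS'.
by rewrite cardsU1 S0 /= subn1 /= add1n ltnS.
Qed.

Lemma dissection_refinable S : is_dissection S -> #|S| < n ->
  exists a x b, refinable S ord0 ord_max a x b.
Proof.
rewrite is_dissectionE => /andP[dS S0] ltS.
by apply: exists_refinable => //=; rewrite subn2.
Qed.

(** The dissections without the refining diagonal a x cancel, and induction applies to those
    containing it. The base case is a triangulation, which has n diagonals. *)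
Lemma euler_dissection S : is_dissection S ->
  (\sum_(T | is_dissection T && (S \subset T)) (-1) ^+ #|T| = (-1) ^+ n :> int)%R.
Proof.
move Em: (n - #|S|) => m; elim: m S Em => [|m IH] S Em dS.
  have eS : #|S| = n by apply/eqP; rewrite eqn_leq card_dissection //; lia.
  rewrite (big_pred1 S) ?eS // => T /=; apply/andP/eqP => [[dT sST]|->] //.
  by apply/esym/eqP; rewrite eqEcard sST eS card_dissection.
have ltS : #|S| < n by lia.
have [a [x [b ref]]] := dissection_refinable dS ltS.
have axS : (a, x) \notin S by case: ref => _ _ _ _ /norP[].
rewrite (bigID (fun T : {set segment} => (a, x) \in T)) /=.
rewrite [X in (_ + X)%R](_ : _ = 0)%R ?GRing.addr0; last first.
  rewrite -[RHS](refinable_sum_sign dS ref); apply: eq_bigl => T.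
  by rewrite andbA.
rewrite -(IH ((a, x) |: S)); last 2 first.
- by rewrite cardsU1 axS add1n; lia.
- exact: refinable_dissection ref.
by apply: eq_bigl => T; rewrite subUset sub1set -andbA [(S \subset T) && _]andbC.
Qed.

End Dissections.

(** * Weighted enumeration of dissections by Motzkin paths *)

Section WeightedDissections.
Variables (n : nat) (R : comPzRingType) (A B : R).
Local Notation vertex := 'I_n.+3.
Local Notation segment := (vertex * vertex)%type.
Implicit Types (a b x y : vertex) (p q : segment) (S T : {set segment}).

(** Homogenised weight: [k] will be the maximal number of segments, [B] marks those present and [A]
    those missing to the maximum. *)
Definition wt k T : R := (A ^+ (k - #|T|) * B ^+ #|T|)%R.

Definition sum_all a b : R := (\sum_(T | dissects a b T) wt (b - a.+1) T)%R.

Definition sum_joined a b : R :=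
  (\sum_(T | dissects a b T && joined T a b) wt (b - a.+1) T)%R.

Definition sum_inner a b : R :=
  (\sum_(T | dissects a b T && ((a, b) \notin T)) wt (b - a.+2) T)%R.

Lemma dissects_edge a b T : a.+1 = b :> nat -> dissects a b T = (T == set0).
Proof.
move=> eb; apply/dissectsP/eqP => [[inT _]|->]; last by split=> [p|p q]; rewrite inE.
apply/setP => p; rewrite inE; apply/negP => /inT; rewrite /within; lia.
Qed.

Lemma sum_all_edge a b : a.+1 = b :> nat -> sum_all a b = 1%R.
Proof.
move=> eb; rewrite /sum_all (big_pred1 set0) => [|T]; last exact: dissects_edge.
by rewrite /wt cards0 -eb subnn mulr1.
Qed.

Lemma sum_joined_edge a b : a.+1 = b :> nat -> sum_joined a b = 1%R.
Proof.
move=> eb; rewrite -(sum_all_edge eb) /sum_joined /sum_all.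
by apply: eq_bigl => T; rewrite /joined eb eqxx andbT.
Qed.

Lemma sum_joined_inner a b : a.+1 < b -> sum_joined a b = (B * sum_inner a b)%R.
Proof.
move=> lt_ab; rewrite /sum_joined /sum_inner big_distrr /=.
rewrite (reindex_onto (fun T => (a, b) |: T) (fun T => T :\ (a, b))) /=; last first.
  move=> T /andP[_ /orP[/eqP e|abT]]; first by move: lt_ab; rewrite e ltnn.
  exact: setD1K.
apply: eq_big => [T | T /andP[_ /eqP e]].
  rewrite /joined setU11 orbT andbT; apply/andP/andP => [[dT /eqP e]|[dT abT]].
    by rewrite -e setD11 e; split=> //; apply: dissects_subset dT; apply: subsetUr.
  by rewrite setU1K ?dissects_setU1.
have abT : (a, b) \notin T by rewrite -e setD11.
rewrite /wt cardsU1 abT add1n exprS mulrCA; congr (_ * (_ ^+ _ * _))%R; lia.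
Qed.

Lemma card_dissects_inner a b T : a.+1 < b -> dissects a b T ->
  (a, b) \notin T -> #|T| <= b - a.+2.
Proof.
move=> lt_ab dT abT; have := card_dissects (ltnW lt_ab) (dissects_setU1 lt_ab dT).
by rewrite cardsU1 abT; move: #|T| => k; clear; lia.
Qed.

(** The base is absent, with factor [A], or present, with factor [B]. *)
Lemma sum_all_inner a b : a.+1 < b -> sum_all a b = ((A + B) * sum_inner a b)%R.
Proof.
move=> lt_ab; rewrite mulrDl -sum_joined_inner // addrC /sum_all.
rewrite (bigID (fun T => joined T a b)) /=; congr (_ + _)%R.
rewrite /sum_inner big_distrr /=; apply: eq_big => [T | T /andP[dT]].
  by rewrite /joined ltn_eqF.
rewrite /joined ltn_eqF //= => abT; have := card_dissects_inner lt_ab dT abT.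
move=> le_T; rewrite /wt mulrA -exprS; congr (_ ^+ _ * _)%R.
by move: #|T| le_T => k; clear -lt_ab; lia.
Qed.

Definition is_split a b T x :=
  [&& a < x, joined T x b & [forall y : vertex, (a < y < x) ==> ~~ joined T y b]].

Lemma is_splitP a b T x :
  reflect [/\ a < x, joined T x b & forall y, a < y < x -> ~~ joined T y b]
          (is_split a b T x).
Proof.
by apply: (iffP and3P) => -[? ?]; [move=> /forallP M | move=> M]; split=> //;
  [move=> y; apply/implyP | apply/forallP => y; apply/implyP; apply: M].
Qed.

Lemma is_split_uniq a b T x y : is_split a b T x -> is_split a b T y -> x = y.
Proof.
move=> /is_splitP[lt_ax Tx minx] /is_splitP[lt_ay Ty miny]; apply: val_inj => /=.
case: (ltngtP x y) => // lt_xy.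
  by have := miny x; rewrite lt_ax lt_xy Tx => /(_ isT).
by have := minx y; rewrite lt_ay lt_xy Ty => /(_ isT).
Qed.

(** [T] is recovered from its restrictions to the two subpolygons. On the right x b must be joined,
    while on the left the base a x is free. *)
Lemma sum_split a b x : a < x < b ->
  (\sum_(T | [&& dissects a b T, (a, b) \notin T & is_split a b T x])
     wt (b - a.+2) T = sum_all a x * sum_joined x b)%R.
Proof.
case/andP=> lt_ax lt_xb; rewrite /sum_all /sum_joined big_distrlr /= pair_big /=.
pose h (T12 : {set segment} * {set segment}) := T12.1 :|: T12.2.
rewrite (reindex_onto h (fun T => (restrict a x T, restrict x b T))) /=; last first.
  by move=> T /and3P[dT abT /is_splitP[_ Tx minx]]; rewrite /h /= -split_union.
apply: eq_big => [[T1 T2] | [T1 T2] /andP[/and3P[dT _ _] /eqP[e1 e2]]]; rewrite /h /=.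
  apply/andP/and3P => [[/and3P[dT abT /is_splitP[_ Tx minx]] /eqP[e1 e2]]|[d1 d2 j2]].
    split; first by rewrite -e1; apply: dissects_restrict dT.
      by rewrite -e2; apply: dissects_restrict dT.
    case/orP: Tx => [e|xbT]; first by rewrite /joined e.
    rewrite /joined -e2 inE xbT /within /= !leqnn /=.
    have [inT _] := dissectsP _ _ _ dT.
    by have /and3P[_ /= -> _] := inT _ xbT; rewrite orbT.
  have [in1 nc1] := dissectsP _ _ _ d1; have [in2 nc2] := dissectsP _ _ _ d2.
  have nc12 p q : p \in T1 -> q \in T2 -> ~~ crossing p q.
    by move=> /in1/and3P[_ ? ?] /in2/and3P[? ? _]; rewrite /crossing; lia.
  split; last first.
    apply/eqP; congr pair; apply/setP => p; rewrite !inE.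
      case: (boolP (p \in T1)) => [/in1 ->//|_] /=.
      by apply/negP => /andP[/in2 /and3P[? ? _] /and3P[_ _ ?]]; lia.
    case: (boolP (p \in T2)) => [/in2 ->|_]; first by rewrite orbT.
    by rewrite orbF; apply/negP => /andP[/in1 /and3P[_ ? ?] /and3P[? _ _]]; lia.
  apply/and3P; split.
  - apply/dissectsP; split=> [p|p q].
      by case/setUP=> [/in1|/in2]; rewrite /within => /and3P[? -> ?] /=; lia.
    case/setUP=> [p1|p2] /setUP[q1|q2].
    + exact: nc1.
    + exact: nc12.
    + by rewrite crossingC nc12.
    + exact: nc2.
  - by apply/negP => /setUP[/in1|/in2] /and3P[/=]; lia.
  - apply/is_splitP; split=> //.
      by case/orP: j2 => [e|xbT]; rewrite /joined ?e // inE xbT !orbT.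
    move=> y /andP[lt_ay lt_yx]; apply/norP; split; first by apply/eqP; lia.
    by apply/negP => /setUP[/in1|/in2] /and3P[/=]; lia.
have d1 : dissects a x T1 by rewrite -e1; apply: dissects_restrict dT.
have d2 : dissects x b T2 by rewrite -e2; apply: dissects_restrict dT.
have [in1 _] := dissectsP _ _ _ d1; have [in2 _] := dissectsP _ _ _ d2.
have c1 := card_dissects lt_ax d1; have c2 := card_dissects lt_xb d2.
rewrite /wt (card_split_union in1 in2) mulrACA -!exprD.
congr (_ ^+ _ * _)%R; move: #|T1| #|T2| c1 c2 => k1 k2; clear -lt_ax lt_xb; lia.
Qed.

Lemma sum_inner_split a b : a.+1 < b ->
  sum_inner a b = (\sum_(x : vertex | (a < x < b)%N) sum_all a x * sum_joined x b)%R.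
Proof.
move=> lt_ab; rewrite -(eq_bigr _ (@sum_split a b)) /sum_inner.
rewrite (exchange_big_dep (fun T => dissects a b T && ((a, b) \notin T))) /=; last first.
  by move=> x T _ /and3P[-> ->].
apply: eq_bigr => T /andP[dT abT].
have [x [lt_ax Tx minx]] := exists_split T lt_ab.
have sx : is_split a b T x by apply/is_splitP.
rewrite (big_pred1 x) // => y; rewrite dT abT /=; apply/andP/eqP => [[_ sy]|->].
  exact: is_split_uniq sy sx.
by rewrite sx lt_ax (joined_lt dT Tx).
Qed.

(** The split at [x] gives the convolution recursion of Motzkin paths: x = a + 1 and x = b - 1
    contribute B and A + B to the level weight, and the other x give a first up step. *)
Lemma sum_inner_motzkin a b : a.+1 < b ->
  sum_inner a b = motzkin (A + B *+ 2)%R (B * (A + B))%R (b - a.+2) 0.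
Proof.
move Em: (b - a.+2) => m; elim/ltn_ind: m a b Em => m IH a b Em lt_ab.
pose D i := motzkin (A + B *+ 2)%R (B * (A + B))%R i 0.
(* Values of [sum_all] and [sum_joined] on the two subpolygons; index 0 stands for a single side. *)
pose cc i := (if i is i'.+1 then (A + B) * D i' else 1)%R.
pose zz i := (if i is i'.+1 then B * D i' else 1)%R.
have -> : sum_inner a b = (\sum_(0 <= i < m.+1) cc i * zz (m - i)%N)%R.
  rewrite sum_inner_split //.
  transitivity (\sum_(x : vertex | (a < x < b)%N) cc (x - a.+1)%N * zz (b - x.+1)%N)%R.
    apply: eq_bigr => x /andP[lt_ax lt_xb]; congr (_ * _)%R.
      case: (ltngtP a.+1 x) => [lt||e]; last 1 first.
      - by rewrite sum_all_edge // e subnn.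
      - rewrite sum_all_inner //.
        have -> : x - a.+1 = (x - a.+2).+1 by lia.
        by rewrite /cc (IH (x - a.+2)) //; lia.
      - by lia.
    case: (ltngtP x.+1 b) => [lt||e]; last 1 first.
    - by rewrite sum_joined_edge // e subnn.
    - rewrite sum_joined_inner //.
      have -> : b - x.+1 = (b - x.+2).+1 by lia.
      by rewrite /zz (IH (b - x.+2)) //; lia.
    - by lia.
  rewrite -(big_mkord (fun i => a < i < b)
              (fun i => cc (i - a.+1)%N * zz (b - i.+1)%N)%R).
  transitivity (\sum_(a.+1 <= i < b) cc (i - a.+1)%N * zz (b - i.+1)%N)%R.
    rewrite (big_nat_widen a.+1 b n.+3 predT) ?(ltnW (ltn_ord b)) //.
    rewrite (big_nat_widenl a.+1 0 n.+3) //.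
    by apply: eq_bigl => i; rewrite andbC.
  rewrite (big_addn 0 b a.+1) (_ : b - a.+1 = m.+1); last by lia.
  rewrite big_nat [RHS]big_nat; apply: eq_bigr => i lt_i.
  by congr (cc _ * zz _)%R; lia.
case: m IH Em => [|m] IH Em; first by rewrite big_nat1 /= mulr1.
rewrite big_nat_recl // big_nat_recr //= subnn.
have -> : (\sum_(0 <= i < m) (A + B) * D i * zz (m.+1 - i.+1)%N =
    motzkin (A + B *+ 2) (B * (A + B)) m 1)%R.
  rewrite motzkin_succ big_distrr /= big_nat [RHS]big_nat; apply: eq_bigr => i lt_i.
  have -> : m.+1 - i.+1 = (m - i.+1).+1 by lia.
  by rewrite /zz /D; ring.
by rewrite /zz /D; ring.
Qed.
End WeightedDissections.

(** * The binomial theorem on a Boolean interval *)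

Section BooleanInterval.
Local Open Scope ring_scope.

Lemma sum_interval (X : finType) (R : comPzRingType) (y z : R) (S U : {set X}) :
  S \subset U ->
  \sum_(T : {set X} | (S \subset T) && (T \subset U))
     y ^+ (#|T| - #|S|) * z ^+ (#|U| - #|T|) = (y + z) ^+ (#|U| - #|S|).
Proof.
move Em: (#|U| - #|S|)%N => m; elim: m S U Em => [|m IH] S U Em sSU.
  have eSU : S = U by apply/eqP; rewrite eqEcard sSU -subn_eq0 Em.
  rewrite (big_pred1 U) => [|T]; first by rewrite eSU subnn mul1r.
  by rewrite eSU /= eqEsubset andbC.
have [r rU rS] : exists2 r, r \in U & r \notin S.
  apply/subsetPn; apply: contraPN Em => sUS.
  by have := subset_leq_card sUS; lia.
have cU := cardsD1 r U; rewrite rU in cU.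
have cS : #|r |: S| = #|S|.+1 by rewrite cardsU1 rS.
rewrite (bigID (fun T : {set X} => r \in T)) /= exprS mulrDl; congr (_ + _).
  rewrite -(IH (r |: S) U); last 2 first.
  - by rewrite cS; lia.
  - by rewrite subUset sub1set rU.
  rewrite big_distrr /=; apply: eq_big => [T | T /andP[/andP[sST sTU] rT]].
    rewrite subUset sub1set [in RHS]andbC -!andbA andbCA.
    by congr (_ && _); rewrite andbC.
  have : r |: S \subset T by rewrite subUset sub1set rT.
  move=> /subset_leq_card; rewrite cS => lt_ST.
  by rewrite mulrA -exprS; congr (_ ^+ _ * _); lia.
rewrite -(IH S (U :\ r)); last 2 first.
- by lia.
- by rewrite subsetD1 sSU.
rewrite big_distrr /=; apply: eq_big => [T | T /andP[/andP[sST sTU] rT]].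
  by rewrite subsetD1 andbA.
have : T \subset U :\ r by rewrite subsetD1 sTU.
move=> /subset_leq_card le_TU.
by rewrite mulrCA -exprS; congr (_ * _ ^+ _); lia.
Qed.
End BooleanInterval.

(** * Palindromic polynomials and their truncations *)

Section Reversal.
Local Open Scope ring_scope.
Implicit Types (p q h : {poly int}) (d k e : nat).

(* x^d p(1/x), for p of degree at most d. *)
Definition rev_poly d p : {poly int} := \poly_(i < d.+1) p`_(d - i).

Lemma coef_rev_poly d p i : (rev_poly d p)`_i = if (i <= d)%N then p`_(d - i) else 0.
Proof. by rewrite coef_poly ltnS. Qed.

Lemma rev_polyD d : {morph rev_poly d : p q / p + q}.
Proof.
by move=> p q; apply/polyP => i; rewrite coefD !coef_rev_poly coefD; case: ifP.
Qed.

Lemma rev_poly0 d : rev_poly d 0 = 0.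
Proof. by apply/polyP => i; rewrite coef_rev_poly !coef0 if_same. Qed.

Lemma rev_polyN d p : rev_poly d (- p) = - rev_poly d p.
Proof.
by apply/polyP => i; rewrite coefN !coef_rev_poly coefN; case: ifP; rewrite ?oppr0.
Qed.

Lemma rev_poly_sum d (I : finType) (P : pred I) (F : I -> {poly int}) :
  rev_poly d (\sum_(i | P i) F i) = \sum_(i | P i) rev_poly d (F i).
Proof. exact: (big_morph _ (rev_polyD d) (rev_poly0 d)). Qed.

Lemma rev_poly_sign d k p : rev_poly d ((-1) ^+ k * p) = (-1) ^+ k * rev_poly d p.
Proof.
rewrite -signr_odd; case: (odd k); last by rewrite !mul1r.
by rewrite !mulN1r rev_polyN.
Qed.

Lemma rev_poly_shift k d p : (size p <= d.+1)%N ->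
  rev_poly (k + d) p = 'X^k * rev_poly d p.
Proof.
move=> sp; apply/polyP => i; rewrite coefXnM !coef_rev_poly.
case: ltnP => le_ki.
  by rewrite nth_default ?if_same //; apply: leq_trans sp _; lia.
have -> : (i <= k + d)%N = (i - k <= d)%N by lia.
by case: ifP => // _; congr (p`_ _); lia.
Qed.

Lemma rev_poly_mulX d p : rev_poly d.+1 ('X * p) = rev_poly d p.
Proof.
apply/polyP => i; rewrite !coef_rev_poly coefXM.
case: (leqP i d) => [le_id|lt_di].
  by rewrite leqW // ifF; [congr (p`_ _); lia | lia].
case: ifP => // le_id; have -> : i = d.+1 by lia.
by rewrite subnn.
Qed.

Lemma rev_poly_mulXsub1 d p : (size p <= d.+1)%N ->
  rev_poly d.+1 (('X - 1) * p) = (1 - 'X) * rev_poly d p.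
Proof.
move=> sp; rewrite mulrBl mul1r rev_polyD rev_polyN rev_poly_mulX -add1n.
by rewrite rev_poly_shift // expr1 mulrBl mul1r.
Qed.

Lemma size_Xsub1_exp k : size (('X - 1 : {poly int}) ^+ k) = k.+1.
Proof. by rewrite -polyC1 size_exp_XsubC. Qed.

Lemma rev_poly_Xsub1_exp k : rev_poly k (('X - 1) ^+ k) = (1 - 'X) ^+ k.
Proof.
elim: k => [|k IH].
  apply/polyP => i; rewrite coef_rev_poly !expr0 !coef1.
  by case: i.
by rewrite exprS rev_poly_mulXsub1 ?size_Xsub1_exp // IH -exprS.
Qed.

Lemma g_of_fE m h : g_of_f m h = \poly_(i < m./2.+1) ((1 - 'X) * h)`_i.
Proof.
apply/polyP => i; rewrite !coef_poly; case: ifP => // _.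
by rewrite mulrBl mul1r coefB coefXM; case: i.
Qed.

(** The product (1 - x) h is antipalindromic of degree e + 1, hence determined by its lower half. *)
Lemma palindromic_g e h : rev_poly e h = h ->
  (1 - 'X) * h = g_of_f e h - rev_poly e.+1 (g_of_f e h).
Proof.
move=> pal; have sh : (size h <= e.+1)%N by rewrite -pal size_poly.
have K i : ((1 - 'X) * h)`_i =
    - (if (i <= e.+1)%N then ((1 - 'X) * h)`_(e.+1 - i) else 0).
  rewrite -coef_rev_poly -coefN -rev_polyN -mulNr opprB rev_poly_mulXsub1 //.
  by rewrite pal.
apply/polyP => i; rewrite coefB coef_rev_poly g_of_fE !coef_poly.
move: (K i); set c := nth _ _; case: (ltnP i) => [lt_i _|le_i].
  rewrite [X in _ - X](_ : _ = 0) ?subr0 //.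
  by case: ifP => // le_ie; rewrite ifF //; lia.
case: ifP => [le_ie|_ ->]; last by rewrite subr0.
case: ifP => [lt ->|]; first by rewrite sub0r.
(* A middle coefficient equals its own negative, so it vanishes. *)
move=> lt; have -> : (e.+1 - i = i)%N by lia.
lia.
Qed.

(* The uniqueness of Kazhdan-Lusztig-Stanley polynomials. *)
Lemma g_of_f_unique d (f g : {poly int}) : (size g <= d./2.+1)%N ->
  (1 - 'X) * f = g - rev_poly d.+1 g -> g_of_f d f = g.
Proof.
move=> sg e; apply/polyP => i; rewrite g_of_fE coef_poly e coefB coef_rev_poly.
case: ltnP => [lt_i|le_i]; last by rewrite nth_default // (leq_trans sg).
rewrite [X in _ - X](_ : _ = 0) ?subr0 //; case: ifP => // le_ie.
by rewrite nth_default // (leq_trans sg) //; lia.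
Qed.
End Reversal.

(** * An upper bound for the rank *)

Section RankBound.
Local Open Scope order_scope.
Context {disp : Order.disp_t} {P : finTBPOrderType disp}.

(** A strictly monotone [r] is injective on chains, and maps those below [y] into the numbers below
    [r y]. *)
Lemma rank_leq (r : P -> nat) (y : P) :
  {homo r : u v / u < v >-> (u < v)%N} -> (rank y <= r y)%N.
Proof.
move=> mono_r; apply/bigmax_leqP => C /andP[/forall_inP chC /forall_inP ltC].
rewrite cardE -(size_map r) -(size_iota 0 (r y)); apply: uniq_leq_size.
  rewrite map_inj_in_uniq ?enum_uniq // => u v; rewrite !mem_enum => uC vC e.
  have /forall_inP/(_ v vC) := chC u uC.
  by rewrite comparable_sym => /comparable_ltgtP[/mono_r|/mono_r|//]; rewrite e ltnn.
by move=> _ /mapP[u + ->]; rewrite mem_enum mem_iota => /ltC/mono_r.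
Qed.
End RankBound.

(** * The h- and g-polynomials of the faces *)

Section AssociahedronToric.
Variable n : nat.
Local Notation vertex := 'I_n.+3.
Local Notation segment := (vertex * vertex)%type.
Implicit Types (S T U : {set segment}).
Local Open Scope ring_scope.

(** The right side is strictly monotone, which bounds the rank from above; successive refinements
    down to a triangulation, then the empty face, give the lower bound. *)
Lemma rank_face (D : dissection n) :
  rank (Some D : associahedron n) = (n - #|val D|).+1.
Proof.
apply/eqP; rewrite eqn_leq; apply/andP; split.
  pose r (F : associahedron n) := if F is Some D then (n - #|val D|).+1 else 0%N.
  apply: (@rank_leq _ _ r) => -[A|] [B|] //; rewrite lt_def => /andP[neBA leAB] //=.
  have := leAB; rewrite /Order.le /= => sBA.
  have lt_BA : (#|val B| < #|val A|)%N.
    rewrite proper_card // properEneq sBA andbT.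
    by apply: contraNneq neBA => e; apply/eqP; congr Some; apply: val_inj.
  by have := card_dissection (valP A); move: #|_| #|_| lt_BA => i j; lia.
move Em: (n - #|val D|)%N => m; elim: m D Em => [|m IH] D Em.
  have : ((None : associahedron n) < Some D)%O by [].
  by move/rank_lt; apply: leq_ltn_trans.
have lt_D : (#|val D| < n)%N by lia.
have [a [x [b ref]]] := dissection_refinable (valP D) lt_D.
have axD : (a, x) \notin val D by case: ref => _ _ _ _ /norP[].
pose E : dissection n := Sub _ (refinable_dissection (valP D) ref).
have cE : #|val E| = #|val D|.+1 by rewrite /= cardsU1 axD.
have : ((Some E : associahedron n) < Some D)%O.
  rewrite lt_def; apply/andP; split; last exact: subsetUr.
  by apply/eqP => -[e]; move: cE; rewrite e; lia.
by move/rank_lt; apply: leq_ltn_trans; apply: IH; lia.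
Qed.

(** This is the dimension of the face labelled by [S]. *)
Local Notation codim S := (n - #|S|)%N.

Lemma euler_codim S : is_dissection S ->
  \sum_(T | is_dissection T && (S \subset T)) (-1) ^+ codim T = 1 :> {poly int}.
Proof.
move=> dS.
have : \sum_(T | is_dissection T && (S \subset T)) (-1) ^+ codim T = 1 :> int.
  transitivity ((-1) ^+ n * (-1) ^+ n : int); last by rewrite -expr2 sqrr_sign.
  rewrite -{2}(euler_dissection dS) big_distrr /=; apply: eq_bigr => T /andP[dT _].
  have -> : (-1) ^+ n = (-1) ^+ codim T * (-1) ^+ #|T| :> int.
    by rewrite -exprD subnK ?card_dissection.
  by rewrite -mulrA -expr2 sqrr_sign mulr1.
move/(congr1 (intr : int -> {poly int})); rewrite rmorph1 rmorph_sum /= => e.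
by rewrite -[RHS]e; apply: eq_bigr => T _; rewrite rmorph_sign.
Qed.

Lemma sum_star_exchange (V : nmodType) S (F : {set segment} -> {set segment} -> V) :
  \sum_(T | is_dissection T && (S \subset T))
    \sum_(U | is_dissection U && (T \subset U)) F T U =
  \sum_(U | is_dissection U && (S \subset U))
    \sum_(T : {set segment} | (S \subset T) && (T \subset U)) F T U.
Proof.
rewrite (exchange_big_dep (fun U => is_dissection U && (S \subset U))) /=; last first.
  by move=> T U /andP[_ sST] /andP[-> sTU]; apply: subset_trans sTU.
apply: eq_bigr => U /andP[dU _]; apply: eq_bigl => T; rewrite dU /=.
case: (boolP (T \subset U)) => [sTU|]; last by rewrite !andbF.
by rewrite (is_dissection_subset sTU dU).
Qed.

(* The h-polynomial of the simple polytope that is the face labelled by S. *)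
Definition h_face S : {poly int} :=
  \sum_(T | is_dissection T && (S \subset T)) ('X - 1) ^+ codim T.

(** The g-polynomial of the simplicial polytope dual to the face. *)
Definition g_link S : {poly int} := g_of_f (codim S) (h_face S).

Definition g_face S : {poly int} :=
  \sum_(T | is_dissection T && (S \subset T)) (-1) ^+ codim T * g_link T.

Lemma codim_leq S T : S \subset T -> is_dissection T ->
  codim S = (#|T| - #|S| + codim T)%N.
Proof.
move=> sST dT; have := subset_leq_card sST; have := card_dissection dT.
by move: #|S| #|T| => i j; lia.
Qed.

Lemma h_face_palindromic S : is_dissection S -> rev_poly (codim S) (h_face S) = h_face S.
Proof.
move=> dS; rewrite {1}/h_face rev_poly_sum.
(* The factor 1 in each term is written as an Euler sum over [U]. After exchange, the sum over [T]
   is a power of x + (1 - x). *)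
transitivity (\sum_(T | is_dissection T && (S \subset T))
  \sum_(U | is_dissection U && (T \subset U))
    (-1) ^+ codim U * ('X^(#|T| - #|S|) * (1 - 'X) ^+ codim T) : {poly int}).
  apply: eq_bigr => T /andP[dT sST]; rewrite -big_distrl /= euler_codim // mul1r.
  by rewrite (codim_leq sST dT) rev_poly_shift ?size_Xsub1_exp // rev_poly_Xsub1_exp.
rewrite sum_star_exchange; apply: eq_bigr => U /andP[dU sSU].
transitivity ((-1) ^+ codim U * (1 - 'X) ^+ codim U *
  ('X + (1 - 'X)) ^+ (#|U| - #|S|) : {poly int}).
  rewrite -(sum_interval _ _ sSU) big_distrr /=; apply: eq_bigr => T /andP[_ sTU].
  by rewrite (codim_leq sTU dU) exprD; ring.
by rewrite ['X + _]addrC subrK expr1n mulr1 -exprMn mulN1r opprB.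
Qed.

Lemma g_link_spec S : is_dissection S ->
  (1 - 'X) * h_face S = g_link S - rev_poly (codim S).+1 (g_link S).
Proof. by move=> dS; apply: palindromic_g (h_face_palindromic dS). Qed.

Lemma size_g_link S : (size (g_link S) <= (codim S)./2.+1)%N.
Proof. exact: size_poly. Qed.

Lemma size_g_face S : (size (g_face S) <= (codim S)./2.+1)%N.
Proof.
apply: (leq_trans (size_sum _ _ _)); apply/bigmax_leqP => T /andP[_ sST].
rewrite -signr_odd mulr_sign.
have -> : size (if odd (codim T) then - g_link T else g_link T) = size (g_link T).
  by case: ifP => // _; rewrite size_polyN.
apply: leq_trans (size_g_link T) _; rewrite ltnS half_leq //.
by have := subset_leq_card sST; lia.
Qed.

(** After exchange, the sum over [U] between S and W is a power of x - 1 by the binomial theorem,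
    and the remaining sum over [W] is Euler's relation. *)
Lemma sum_sign_h_face S : is_dissection S ->
  \sum_(U | is_dissection U && (S \subset U))
     (-1) ^+ codim U * ('X^(#|U| - #|S|) * h_face U) = ('X - 1) ^+ codim S.
Proof.
move=> dS.
transitivity (\sum_(U | is_dissection U && (S \subset U))
  \sum_(W | is_dissection W && (U \subset W))
    ((-1) ^+ codim U * 'X^(#|U| - #|S|) * ('X - 1) ^+ codim W : {poly int})).
  by apply: eq_bigr => U _; rewrite mulrA -big_distrr.
rewrite sum_star_exchange -[RHS]mulr1 -[X in _ = _ * X](euler_codim dS) big_distrr /=.
apply: eq_bigr => W /andP[dW sSW].
rewrite [in RHS](codim_leq sSW dW) exprD -(sum_interval _ _ sSW) -mulrA big_distrl /=.
apply: eq_bigr => U /andP[sSU sUW].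
by rewrite (codim_leq sUW dW) exprD; ring.
Qed.

(** The Kazhdan-Lusztig-Stanley relation for [g_face]; the subtracted power of ['X - 1] is the
    contribution of the empty face. *)
Lemma sum_g_face S : is_dissection S ->
  \sum_(T | is_dissection T && (S \subset T)) g_face T * ('X - 1) ^+ (#|T| - #|S|) =
  rev_poly (codim S).+1 (g_face S) - ('X - 1) ^+ (codim S).+1.
Proof.
move=> dS.
have -> : \sum_(T | is_dissection T && (S \subset T))
      g_face T * ('X - 1) ^+ (#|T| - #|S|) =
    \sum_(U | is_dissection U && (S \subset U))
      (-1) ^+ codim U * ('X^(#|U| - #|S|) * g_link U).
  transitivity (\sum_(T | is_dissection T && (S \subset T))
      \sum_(U | is_dissection U && (T \subset U))
        (-1) ^+ codim U * g_link U * ('X - 1) ^+ (#|T| - #|S|)).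
    by apply: eq_bigr => T _; rewrite big_distrl.
  rewrite sum_star_exchange; apply: eq_bigr => U /andP[dU sSU].
  rewrite -big_distrr /= -mulrA [_ * g_link U]mulrC; congr (_ * (_ * _)).
  (* The power of x is expanded with x = (x - 1) + 1. *)
  rewrite -[X in X ^+ _](subrK 1) -(sum_interval _ _ sSU).
  by apply: eq_bigr => T _; rewrite expr1n mulr1.
rewrite exprS -(sum_sign_h_face dS) rev_poly_sum big_distrr -sumrB /=.
apply: eq_bigr => U /andP[dU sSU].
rewrite rev_poly_sign (codim_leq sSU dU) -addnS rev_poly_shift; last first.
  by apply: leq_trans (size_g_link U) _; lia.
have e := g_link_spec dU.
have {e} -> : rev_poly (codim U).+1 (g_link U) = g_link U + ('X - 1) * h_face U.
  by rewrite -[LHS]opprK -[- rev_poly _ _](addKr (g_link U)) -e; ring.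
ring.
Qed.
End AssociahedronToric.

(** * The toric g-polynomial as a functional of the Motzkin polynomial *)

Section ToricFaces.
Variable n : nat.
Local Notation vertex := 'I_n.+3.
Local Notation segment := (vertex * vertex)%type.
Implicit Types (S T U : {set segment}).
Local Open Scope ring_scope.
Local Notation codim S := (n - #|S|)%N.

Lemma sum_faces (D : dissection n) (F : associahedron n -> {poly int})
    (G : {set segment} -> {poly int}) :
  (forall E : dissection n, ((Some E : associahedron n) < Some D)%O ->
     F (Some E) = G (val E)) ->
  \sum_(z : associahedron n | (z < Some D)%O) F z =
  F None + \sum_(T | is_dissection T && (val D \proper T)) G T.
Proof.
move=> eFG; rewrite (bigD1 (None : associahedron n)) //=; congr (_ + _).
(* A set that is no dissection is sent to the default [D], which is not strictly below itself and so
   drops out. *)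
rewrite (reindex_onto (fun T : {set segment} => Some (insubd D T) : associahedron n)
  (fun z => if z is Some E then val E else set0)) /=; last first.
  by case=> [E|] /andP[] //= _ _; rewrite valKd.
have lt_SD T : is_dissection T ->
    ((Some (insubd D T) : associahedron n) < Some D)%O = (val D \proper T).
  move=> dT; rewrite lt_def properEneq /Order.le /= insubdK //; congr (~~ _ && _).
  by apply/eqP/eqP => [[->]|e]; [rewrite insubdK | rewrite -e valKd].
apply: eq_big => [T | T /andP[/andP[lt_T _] /eqP eT]].
  apply/idP/idP => [/andP[/andP[lt_T _] /eqP eT]|/andP[dT pT]].
    have dT : is_dissection T by rewrite -eT (valP (insubd D T)).
    by rewrite dT -lt_SD.
  by rewrite lt_SD // pT /= insubdK.
by rewrite eFG //; congr G; exact: eT.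
Qed.

(** Induction on the dimension: once the proper faces are known, [sum_g_face] shows that [g_face]
    has the property characterising g in [g_of_f_unique]. *)
Lemma toric_g_face (D : dissection n) :
  toric_g (Some D : associahedron n) = g_face (val D).
Proof.
move Em: (codim (val D)) => m; elim/ltn_ind: m D Em => m IH D Em.
rewrite toric_gE rank_face; apply: g_of_f_unique; first exact: size_g_face.
rewrite /toric_f rank_face.
(* A face E has rank n - |E| + 1, so the exponent of ['X - 1] is |E| - |D| - 1; the missing factor
   comes from 1 - x. *)
rewrite (@sum_faces D _ (fun T => g_face T * ('X - 1) ^+ (#|T| - #|val D|).-1)).
  have -> : toric_g (None : associahedron n) = 1.
    by rewrite toric_gE (rank_bot : rank (None : associahedron n) = 0%N).
  rewrite (rank_bot : rank (None : associahedron n) = 0%N) subn0 mul1r mulrDr.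
  have dD : is_dissection (val D) by exact: valP.
  have := sum_g_face dD.
  rewrite (bigD1 (val D)) ?dD ?subxx //= subnn mulr1 => e.
  have -> : rev_poly (codim (val D)).+1 (g_face (val D)) =
      ('X - 1) ^+ (codim (val D)).+1 + (g_face (val D)
      + \sum_(T | is_dissection T && (val D \subset T) && (T != val D))
          g_face T * ('X - 1) ^+ (#|T| - #|val D|)).
    by rewrite e addrC subrK.
  have -> : (1 - 'X) * \sum_(T | is_dissection T && (val D \proper T))
        g_face T * ('X - 1) ^+ (#|T| - #|val D|).-1 =
      - \sum_(T | is_dissection T && (val D \subset T) && (T != val D))
        g_face T * ('X - 1) ^+ (#|T| - #|val D|).
    rewrite -sumrN big_distrr /=; apply: eq_big => [T | T /andP[dT pT]].
      by rewrite properEneq eq_sym andbA andbAC.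
    rewrite -[in RHS](prednK (n := #|T| - #|val D|)) ?subn_gt0 ?proper_card //.
    by rewrite exprS; ring.
  by rewrite exprS; ring.
move=> E; rewrite lt_def => /andP[neED]; rewrite /Order.le /= => sDE.
have lt_DE : (#|val D| < #|val E|)%N.
  rewrite proper_card // properEneq sDE andbT.
  by apply: contraNneq neED => e; apply/eqP; congr Some; apply: val_inj.
have le_En := card_dissection (valP E).
rewrite (IH (codim (val E))) //; last by move: #|_| #|_| lt_DE le_En Em => i j; lia.
rewrite rank_face; congr (_ * _ ^+ _).
by move: #|_| #|_| lt_DE le_En => i j; lia.
Qed.

Lemma toric_g_associahedron :
  toric_g_poly (associahedron n) = g_face (set0 : {set segment}).
Proof. exact: (toric_g_face (Sub set0 (is_dissection0 n))). Qed.

Local Notation bipoly := {poly {poly int}}.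
Local Notation U := ('X : bipoly).
Local Notation V := ('X%:P : bipoly).

(** The polynomial is homogeneous of degree e + m and becomes (x - 1)^e at u = x, v = 1. *)
Lemma coef_sub_exp e m k j :
  ((U - V) ^+ e * V ^+ m)`_k`_j =
  if (k + j == e + m)%N then (('X - 1 : {poly int}) ^+ e)`_k else 0.
Proof.
elim: e k j => [|e IH] k j.
  rewrite expr0 mul1r -polyC_exp coefC expr0 coef1 add0n.
  case: k => [|k]; rewrite ?coefXn ?coef0 /=; first by case: eqP.
  by rewrite if_same.
rewrite exprS -mulrA mulrBl coef2D coef2N coefUM coefVM addSn.
rewrite exprS mulrBl mul1r coefB coefXM.
case: k j => [|k] [|j]; rewrite ?IH ?addSn ?addnS ?addn0 ?add0n ?eqSS //=.
- by case: ifP => _; ring.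
- case: eqP => [ek|_]; rewrite ?subr0 //.
  by rewrite [X in _ = _ - X]nth_default ?subr0 // size_Xsub1_exp; lia.
- by case: ifP => _; ring.
Qed.
(** Expanding (1 - v)^|W| over the subsets [T] of [W] writes H as the signed sum of the
    h-polynomials of the faces, homogenised to degree n - |T|. *)
Lemma motz_dissections :
  motz n 0 = \sum_(T | is_dissection T && ((set0 : {set segment}) \subset T))
    \sum_(W | is_dissection W && (T \subset W))
      (-1) ^+ codim T * ((U - V) ^+ codim W * V ^+ (#|W| - #|T|)).
Proof.
have := @sum_inner_motzkin n _ (V - U) (1 - V) ord0 ord_max isT.
rewrite /= subn2 /= /motz => M.
have -> : level = V - U + (1 - V) *+ 2 by rewrite /level; ring.
have -> : updown = (1 - V) * (V - U + (1 - V)) by rewrite /updown /level; ring.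
rewrite -{}M sum_star_exchange /sum_inner.
apply: eq_big => [W | W]; first by rewrite -is_dissectionE sub0set andbT.
rewrite -is_dissectionE => dW; rewrite /wt /= subn2 /=.
transitivity ((-1) ^+ codim W * (U - V) ^+ codim W * (1 - V) ^+ #|W|).
  by rewrite -exprMn mulN1r opprB.
have := sum_interval 1 (- V) (sub0set W); rewrite cards0 subn0 => <-.
rewrite big_distrr /=; apply: eq_bigr => T /andP[_ sTW].
by rewrite expr1n mul1r [(- V) ^+ _]exprNn (codim_leq sTW dW) exprD; ring.
Qed.

Lemma coef_motz k j : (motz n 0)`_k`_j =
  \sum_(T : {set segment} | is_dissection T && (set0 \subset T))
    (-1) ^+ codim T * (if (k + j == codim T)%N then (h_face T)`_k else 0).
Proof.
rewrite motz_dissections !coef_sum; apply: eq_bigr => T /andP[dT _].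
rewrite -big_distrr /= -signr_odd.
have -> (f : bipoly) b : ((-1) ^+ odd b * f)`_k`_j = (-1) ^+ odd b * f`_k`_j.
  by case: (odd b); rewrite ?mul1r // !mulN1r coef2N.
rewrite signr_odd !coef_sum; congr (_ * _).
have E W : is_dissection W && (T \subset W) ->
    ((U - V) ^+ codim W * V ^+ (#|W| - #|T|))`_k`_j =
    if (k + j == codim T)%N then (('X - 1 : {poly int}) ^+ codim W)`_k else 0.
  by case/andP=> dW sTW; rewrite coef_sub_exp (codim_leq sTW dW) (addnC (codim W)).
rewrite (eq_bigr _ E); case: ifP => // _; exact: big1.
Qed.

(** Only e = c - 2k can contribute, and it exists when 2k <= c: this is the truncation made by
    [g_of_f]. *)
Lemma sum_diagonal k c (x : int) : (c <= n)%N ->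
  \sum_(0 <= e < n.+1) (if (k + (k + e) == c)%N then x else 0) =
  if (k < c./2.+1)%N then x else 0.
Proof.
move=> le_cn; rewrite big_mkord; case: ltnP => lt_kc.
  have lt_e : (c - (k + k) < n.+1)%N by lia.
  rewrite (bigD1 (Ordinal lt_e)) //= big1 => [|e].
    by rewrite ifT ?addr0 //; lia.
  move/eqP => ne; rewrite ifF //; apply/eqP => ek; apply: ne.
  by apply: val_inj => /=; lia.
by rewrite big1 // => e _; rewrite ifF //; lia.
Qed.
(** On a homogenised h of degree c, the functionals [tau e] together yield h_k - h_(k-1) for k <=
    c/2, the coefficients of [g_link]. *)
Lemma coef_g_face0 k : (g_face (set0 : {set segment}))`_k =
  (\sum_(0 <= e < n.+1) tau e (motz n 0))`_k.
Proof.
rewrite coef_sum; under [in RHS]eq_bigr do rewrite coef_tau.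
pose dlt (T : {set segment}) :=
  (h_face T)`_k - (if k is k'.+1 then (h_face T)`_k' else 0).
transitivity (\sum_(T : {set segment} | is_dissection T && (set0 \subset T))
   \sum_(0 <= e < n.+1)
     (-1) ^+ codim T * (if (k + (k + e) == codim T)%N then dlt T else 0)).
  rewrite coef_sum; apply: eq_bigr => T _.
  rewrite -big_distrr /= sum_diagonal ?leq_subr // -signr_odd.
  have -> (f : {poly int}) b : ((-1) ^+ odd b * f)`_k = (-1) ^+ odd b * f`_k.
    by case: (odd b); rewrite ?mul1r // !mulN1r coefN.
  by rewrite signr_odd coef_poly.
rewrite exchange_big /=; apply: eq_bigr => e _.
case: k @dlt => [|k] dlt; rewrite !coef_motz ?subr0.
  by apply: eq_bigr => T _; rewrite /dlt subr0.
rewrite -sumrB; apply: eq_bigr => T _.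
by rewrite -mulrBr /dlt addSnnS addnS; case: ifP; rewrite ?subrr.
Qed.
End ToricFaces.

Theorem theorem6p2 (n k : nat) (hn : (1 <= n)%N) :
  ((toric_g_poly (associahedron n))`_k)%R =
  Posz #|[set f : {ffun 'I_n -> 'I_n} |
           [&& is_parking f, avoids123 f & #|ascents f| == k]]|.
Proof.
rewrite toric_g_associahedron coef_g_face0 -(@sum_weight_asc_words n.+1) //.
rewrite card_parking_words coef_sum -sum1_count.
rewrite (big_morph Posz PoszD (erefl : Posz 0 = 0%R)) [RHS]big_mkcond /=.
apply: eq_bigr => w _.
by rewrite /weight_asc coefXn eq_sym; case: eqP.
Qed.
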